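(* There is a universal implied constant such that the following holds. Let $C_f>0$, $0<\mu\leq 1/2$ and $0<|\nu|\leq 1/2$. Let $u$ be a (sufficiently smooth) solution, spatially compactly supported in $\mathcal K$, of $$-\Box u=f,\qquad u|_{t=2}=0,\qquad \partial_tu|_{t=2}=0,$$ where the source $f$ is spatially compactly supported in $\mathcal K$ and satisfies, in $\mathcal K\cap\{t\ge 2\}$, $$|f(t,x)|\leq C_f\,t^{-2-\nu}(t-r)^{-1+\mu}.$$ Then, for all $(t,x)\in\mathcal K$ with $t\ge2$, $$|u(t,x)|\lesssim\begin{cases}\dfrac{C_f}{\nu\mu}\,(t-r)^{\mu-\nu}\,t^{-1}, & 0<\nu\leq 1/2,\\[2mm] \dfrac{C_f}{|\nu|\mu}\,(t-r)^{\mu}\,t^{-1-\nu}, & -1/2\leq\nu<0.\end{cases}$$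
   Context: Coordinates on $\mathbb{R}^{3+1}$ are $(t,x)$ with $x\in\mathbb{R}^3$, $r=|x|$, and $\Box=-\partial_t^2+\sum_{a=1}^3\partial_a^2$. $\mathcal K=\{(t,x): r<t-1\}$ is the interior of the future light cone with vertex $(1,0,0,0)$. A function is ''spatially compactly supported in $\mathcal K$'' if (for $t\ge2$) it is supported in $\mathcal K$ and vanishes in a neighborhood of the light cone $\{r=t-1\}$. $A\lesssim B$ means $A\le CB$ with $C$ independent of $u,f,C_f,\mu,\nu,t,x$. *)

(* Defs.v *)
From Stdlib Require Import Reals.
From Coquelicot Require Import Coquelicot.

Open Scope R_scope.

(* A point of R^{3+1} is a tuple (t, x1, x2, x3). *)
Definition time (p : R * R * R * R) : R :=
  let '(t, _, _, _) := p in t.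

Definition radius (p : R * R * R * R) : R :=
  let '(_, x1, x2, x3) := p in sqrt (x1 ^ 2 + x2 ^ 2 + x3 ^ 2).

Definition K (p : R * R * R * R) : Prop := radius p < time p - 1.

Inductive axis : Set := At | A1 | A2 | A3.

Definition coord (i : axis) (p : R * R * R * R) : R :=
  let '(t, x1, x2, x3) := p in
  match i with At => t | A1 => x1 | A2 => x2 | A3 => x3 end.

Definition set_coord (i : axis) (p : R * R * R * R) (s : R) : R * R * R * R :=
  let '(t, x1, x2, x3) := p in
  match i with
  | At => (s, x1, x2, x3)
  | A1 => (t, s, x2, x3)
  | A2 => (t, x1, s, x3)
  | A3 => (t, x1, x2, s)
  end.

Definition ex_partial (i : axis) (g : R * R * R * R -> R)
    (p : R * R * R * R) : Prop :=
  ex_derive (fun s => g (set_coord i p s)) (coord i p).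

Definition partial (i : axis) (g : R * R * R * R -> R)
    (p : R * R * R * R) : R :=
  Derive (fun s => g (set_coord i p s)) (coord i p).

Definition Box (g : R * R * R * R -> R) (p : R * R * R * R) : R :=
  - partial At (partial At g) p
  + partial A1 (partial A1 g) p
  + partial A2 (partial A2 g) p
  + partial A3 (partial A3 g) p.

(* Meant for open D, where the existence and continuity of the partial
   derivatives is the usual C^1 condition. *)
Definition C1_on (D : R * R * R * R -> Prop) (g : R * R * R * R -> R) : Prop :=
  forall p, D p -> forall i, ex_partial i g p /\ continuous (partial i g) p.

Definition C2_on (D : R * R * R * R -> Prop) (g : R * R * R * R -> R) : Prop :=
  C1_on D g /\ forall i, C1_on D (partial i g).

(* Regularity of a classical solution of the Cauchy problem on {t >= 2}:
   C^2 for t > 2 and C^1 up to the initial slice, that is, u is continuous on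
   {t >= 2} and its first derivatives extend continuously from {t > 2} to
   {t >= 2}.  Values of u at times t < 2 play no role. *)
Definition classical_regularity (u : R * R * R * R -> R) : Prop :=
  C2_on (fun p => 2 < time p) u /\
  (forall p, 2 <= time p ->
     filterlim u (within (fun q => 2 <= time q) (locally p)) (locally (u p))) /\
  (forall i p, time p = 2 -> exists l : R,
     filterlim (partial i u) (within (fun q => 2 < time q) (locally p))
       (locally l)).

(* The time derivative on the initial slice t = 2 is one-sided. *)
Definition is_initial_dt (u : R * R * R * R -> R) (x1 x2 x3 l : R) : Prop :=
  filterlim (fun h => (u (2 + h, x1, x2, x3) - u (2, x1, x2, x3)) / h)
    (at_right 0) (locally l).

Definition spatially_compactly_supported_in_K (g : R * R * R * R -> R) : Prop :=
  (forall p, 2 <= time p -> ~ K p -> g p = 0) /\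
  (forall p, 2 <= time p -> radius p = time p - 1 ->
     locally p (fun q => 2 <= time q -> g q = 0)).

(* Main.v *)
(** With M(t, r) the mean of w over the sphere of radius r about x, one has
    d/dr of (d_r + d_t)(r M)(t0 - r, r) = r times the spherical mean of Box w (Kirchhoff).
    Hence a supersolution W of the wave equation with -Box W >= |f| and suitable data at
    t = 2 dominates |u|, and it suffices to exhibit W.

    With s = t^2 - r^2 one computes
      -Box (t^a s^b) = a (a - 1) t^(a-2) s^b + 4 b (a + b + 1) t^a s^(b-1),
    and s is comparable to t (t - r).  For nu < 0 take V = c t^(-1-nu-mu) s^mu, for nu > 0
    take V = 8 c t^(-1-mu+nu) s^(mu-nu) - c t^(-1-nu-mu) s^mu, with c = Cf / (2 |nu| mu); the
    term 4 |nu| mu c t^(-1-nu-mu) s^(mu-1) controls the source.  V is cut off by a smooth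
    nondecreasing chi(t - r), which keeps the right sign because (d_t + d_r)(r V) >= 0, and
    the data of the result at t = 2 are compensated by a multiple of the explicit positive
    solution Im 1/(r^2 - (t - 2 + i)^2), which decays like t^(-1) (t - r)^(-2). *)

From Stdlib Require Import Reals Lra Classical ClassicalEpsilon.
From Coquelicot Require Import Coquelicot.
Require Import Defs.

Open Scope R_scope.

(** * Functions of class C^1 on R^4 *)


(** The sign of nu enters through the factor a + b + 1, which is -nu for a = -1-nu-mu, b = mu. For
    nu < 0 this power is itself a supersolution. For nu > 0 it has the wrong sign and is subtracted;
    the power with b = mu-nu, for which a + b + 1 = 0, then pays with its term a (a - 1) t^(a-2)
    s^b. Both powers have the same homogeneity in (t, r), which makes these terms comparable. The
    factor 1 / (|nu| mu) of the estimate is the price of the coefficient 4 b (a + b + 1). The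
    backward cone of a point of K may leave {r < t}, where V has no meaning; this forces the
    cut-off. It varies only on 1/2 < t - r < 1, outside K, where the source vanishes and only the
    sign of Box matters. It spoils the data at t = 2, but a solution with zero value and positive
    velocity there repairs them without changing Box. Kirchhoff's identity is never integrated: the
    mean value theorem along one cone suffices. Since u is regular only for t > 2, with limits at t
    = 2, it is extended by zero. *)

Lemma continuous_pair {T U V : UniformSpace} (f : T -> U) (g : T -> V) (x : T) :
  continuous f x -> continuous g x -> continuous (fun y => (f y, g y)) x.
Proof.
  intros Hf Hg P [eps HP].
  generalize (Hf _ (locally_ball (f x) eps)), (Hg _ (locally_ball (g x) eps)).
  unfold filtermap.
  intros H1 H2. generalize (filter_and _ _ H1 H2).
  apply filter_imp. intros y [Hy1 Hy2]. apply HP. split; assumption.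
Qed.

Lemma is_derive_continuous_R (f : R -> R) (x l : R) :
  is_derive f x l -> continuous f x.
Proof. intros H. apply (ex_derive_continuous f x). exists l; exact H. Qed.

Lemma increment_bound (f df : R -> R) (a b l eps : R) :
  (forall s, Rmin a b <= s <= Rmax a b -> is_derive f s (df s)) ->
  (forall s, Rmin a b <= s <= Rmax a b -> Rabs (df s - l) <= eps) ->
  Rabs (f b - f a - l * (b - a)) <= eps * Rabs (b - a).
Proof.
  intros Hd Hb.
  destruct (MVT_gen f a b df) as [c [Hc E]].
  - intros s Hs. apply Hd. lra.
  - intros s Hs. apply continuity_pt_filterlim.
    exact (is_derive_continuous_R f s (df s) (Hd s Hs)).
  - rewrite E. replace (df c * (b - a) - l * (b - a)) with ((df c - l) * (b - a)) by ring.
    rewrite Rabs_mult. apply Rmult_le_compat_r; [apply Rabs_pos | exact (Hb c Hc)].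
Qed.

Lemma Rabs_between (p a b s d : R) :
  Rabs (a - p) < d -> Rabs (b - p) < d -> Rmin a b <= s <= Rmax a b -> Rabs (s - p) < d.
Proof.
  intros Ha Hb Hs. apply Rabs_def2 in Ha. apply Rabs_def2 in Hb. apply Rabs_def1;
  unfold Rmin, Rmax in Hs; destruct (Rle_dec a b); lra.
Qed.

Definition gradient_form (g : R * R * R * R -> R) (p h : R * R * R * R) : R :=
  partial At g p * coord At h + partial A1 g p * coord A1 h
  + partial A2 g p * coord A2 h + partial A3 g p * coord A3 h.

Lemma locally_R4 (P : R * R * R * R -> Prop) (t x1 x2 x3 : R) :
  locally (t, x1, x2, x3) P <->
  exists d : posreal, forall t' y1 y2 y3 : R,
    Rabs (t' - t) < d -> Rabs (y1 - x1) < d -> Rabs (y2 - x2) < d -> Rabs (y3 - x3) < d ->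
    P (t', y1, y2, y3).
Proof.
  split; intros [d Hd]; exists d.
  - intros t' y1 y2 y3 H0 H1 H2 H3. apply Hd. repeat split; assumption.
  - intros [[[t' y1] y2] y3] [[[H0 H1] H2] H3]. exact (Hd t' y1 y2 y3 H0 H1 H2 H3).
Qed.

(** [C1_on] only gives partial derivatives. Moving one coordinate at a time splits the increment
    along four axis-parallel segments, which stay in a box where every partial is within eps of its
    value at p; the mean value inequality applies on each. *)
Lemma C1_increment (D : R * R * R * R -> Prop) (g : R * R * R * R -> R) (p : R * R * R * R)
    (eps : posreal) :
  open D -> C1_on D g -> D p ->
  locally p (fun q =>
    Rabs (g q - g p - gradient_form g p
      (coord At q - coord At p, coord A1 q - coord A1 p,
       coord A2 q - coord A2 p, coord A3 q - coord A3 p))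
    <= eps * (Rabs (coord At q - coord At p) + Rabs (coord A1 q - coord A1 p)
      + Rabs (coord A2 q - coord A2 p) + Rabs (coord A3 q - coord A3 p))).
Proof.
  intros HD Hg Hp.
  assert (Hi : forall i, locally p (fun q => Rabs (partial i g q - partial i g p) < eps)).
  { intros i. exact (proj2 (Hg p Hp i) _ (locally_ball (partial i g p) eps)). }
  assert (Hloc : locally p (fun q => D q /\
    forall i, Rabs (partial i g q - partial i g p) < eps)).
  { apply filter_and; [exact (HD p Hp) |].
    generalize (filter_and _ _ (filter_and _ _ (Hi At) (Hi A1))
      (filter_and _ _ (Hi A2) (Hi A3))).
    apply filter_imp. intros q [[H0 H1] [H2 H3]] i; destruct i; assumption. }
  destruct p as [[[t x1] x2] x3].
  apply locally_R4 in Hloc. destruct Hloc as [d Hd]. apply locally_R4. exists d.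
  intros t' y1 y2 y3 Ht H1 H2 H3.
  assert (Z : forall z : R, Rabs (z - z) < d).
  { intros z. replace (z - z) with 0 by ring. rewrite Rabs_R0. apply cond_pos. }
  assert (Hin : forall a b c e, Rabs (a - t) < d -> Rabs (b - x1) < d -> Rabs (c - x2) < d ->
     Rabs (e - x3) < d -> D (a, b, c, e) /\
     forall i, Rabs (partial i g (a, b, c, e) - partial i g (t, x1, x2, x3)) < eps).
  { intros. apply Hd; assumption. }
  assert (E0 := increment_bound (fun s => g (s, y1, y2, y3)) (fun s => partial At g (s, y1, y2, y3))
     t t' (partial At g (t, x1, x2, x3)) eps).
  assert (E1 := increment_bound (fun s => g (t, s, y2, y3)) (fun s => partial A1 g (t, s, y2, y3))
     x1 y1 (partial A1 g (t, x1, x2, x3)) eps).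
  assert (E2 := increment_bound (fun s => g (t, x1, s, y3)) (fun s => partial A2 g (t, x1, s, y3))
     x2 y2 (partial A2 g (t, x1, x2, x3)) eps).
  assert (E3 := increment_bound (fun s => g (t, x1, x2, s)) (fun s => partial A3 g (t, x1, x2, s))
     x3 y3 (partial A3 g (t, x1, x2, x3)) eps).
  assert (B0 : Rabs (g (t', y1, y2, y3) - g (t, y1, y2, y3)
     - partial At g (t, x1, x2, x3) * (t' - t)) <= eps * Rabs (t' - t)).
  { apply E0; intros s Hs; assert (Hs' := Rabs_between t t t' s d (Z t) Ht Hs);
    destruct (Hin s y1 y2 y3 Hs' H1 H2 H3) as [I1 I2].
    - apply (Derive_correct (fun s => g (s, y1, y2, y3))). apply (proj1 (Hg _ I1 At)).
    - left. apply (I2 At). }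
  assert (B1 : Rabs (g (t, y1, y2, y3) - g (t, x1, y2, y3)
     - partial A1 g (t, x1, x2, x3) * (y1 - x1)) <= eps * Rabs (y1 - x1)).
  { apply E1; intros s Hs; assert (Hs' := Rabs_between x1 x1 y1 s d (Z x1) H1 Hs);
    destruct (Hin t s y2 y3 (Z t) Hs' H2 H3) as [I1 I2].
    - apply (Derive_correct (fun s => g (t, s, y2, y3))). apply (proj1 (Hg _ I1 A1)).
    - left. apply (I2 A1). }
  assert (B2 : Rabs (g (t, x1, y2, y3) - g (t, x1, x2, y3)
     - partial A2 g (t, x1, x2, x3) * (y2 - x2)) <= eps * Rabs (y2 - x2)).
  { apply E2; intros s Hs; assert (Hs' := Rabs_between x2 x2 y2 s d (Z x2) H2 Hs);
    destruct (Hin t x1 s y3 (Z t) (Z x1) Hs' H3) as [I1 I2].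
    - apply (Derive_correct (fun s => g (t, x1, s, y3))). apply (proj1 (Hg _ I1 A2)).
    - left. apply (I2 A2). }
  assert (B3 : Rabs (g (t, x1, x2, y3) - g (t, x1, x2, x3)
     - partial A3 g (t, x1, x2, x3) * (y3 - x3)) <= eps * Rabs (y3 - x3)).
  { apply E3; intros s Hs; assert (Hs' := Rabs_between x3 x3 y3 s d (Z x3) H3 Hs);
    destruct (Hin t x1 x2 s (Z t) (Z x1) (Z x2) Hs') as [I1 I2].
    - apply (Derive_correct (fun s => g (t, x1, x2, s))). apply (proj1 (Hg _ I1 A3)).
    - left. apply (I2 A3). }
  unfold gradient_form, coord.
  apply Rabs_le_between in B0. apply Rabs_le_between in B1.
  apply Rabs_le_between in B2. apply Rabs_le_between in B3.
  apply Rabs_le_between. split; lra.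
Qed.

Lemma C1_on_continuous (D : R * R * R * R -> Prop) (g : R * R * R * R -> R) (p : R * R * R * R) :
  open D -> C1_on D g -> D p -> continuous g p.
Proof.
  intros HD Hg Hp P [eps HP].
  assert (H := C1_increment D g p (mkposreal 1 Rlt_0_1) HD Hg Hp).
  set (M := Rabs (partial At g p) + Rabs (partial A1 g p) + Rabs (partial A2 g p)
            + Rabs (partial A3 g p) + 4).
  assert (HM : 0 < M).
  { unfold M. generalize (Rabs_pos (partial At g p)), (Rabs_pos (partial A1 g p)),
      (Rabs_pos (partial A2 g p)), (Rabs_pos (partial A3 g p)). lra. }
  assert (He : 0 < eps / M) by (apply Rdiv_lt_0_compat; [apply cond_pos | exact HM]).
  destruct p as [[[t x1] x2] x3].
  apply locally_R4 in H. destruct H as [d Hd]. apply locally_R4.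
  assert (Hd' : 0 < Rmin d (eps / M)) by (apply Rmin_glb_lt; [apply cond_pos | exact He]).
  exists (mkposreal _ Hd'). simpl pos.
  intros t' y1 y2 y3 H0 H1 H2 H3. apply HP.
  assert (Hm1 := Rmin_l d (eps / M)). assert (Hm2 := Rmin_r d (eps / M)).
  assert (Hq := Hd t' y1 y2 y3 ltac:(lra) ltac:(lra) ltac:(lra) ltac:(lra)).
  apply Rlt_le_trans with (2 := Hm2) in H0. apply Rlt_le_trans with (2 := Hm2) in H1.
  apply Rlt_le_trans with (2 := Hm2) in H2. apply Rlt_le_trans with (2 := Hm2) in H3.
  simpl pos in Hq. unfold gradient_form, coord in Hq.
  change (Rabs (g (t', y1, y2, y3) - g (t, x1, x2, x3)) < eps).
  set (e := eps / M) in *.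
  assert (Ee : eps = e * M :> R) by (unfold e; field; lra). rewrite Ee.
  assert (K : forall a h, Rabs h < e -> Rabs (a * h) <= Rabs a * e).
  { intros a h Hh. rewrite Rabs_mult. apply Rmult_le_compat_l; [apply Rabs_pos | lra]. }
  assert (K0 := K (partial At g (t, x1, x2, x3)) _ H0).
  assert (K1 := K (partial A1 g (t, x1, x2, x3)) _ H1).
  assert (K2 := K (partial A2 g (t, x1, x2, x3)) _ H2).
  assert (K3 := K (partial A3 g (t, x1, x2, x3)) _ H3).
  apply Rabs_le_between in K0. apply Rabs_le_between in K1.
  apply Rabs_le_between in K2. apply Rabs_le_between in K3.
  apply Rabs_le_between in Hq.
  assert (EM : e * M = Rabs (partial At g (t, x1, x2, x3)) * e + Rabs (partial A1 g (t, x1, x2, x3)) * e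
     + Rabs (partial A2 g (t, x1, x2, x3)) * e + Rabs (partial A3 g (t, x1, x2, x3)) * e + 4 * e)
    by (unfold M; ring).
  rewrite EM. apply Rabs_def1; lra.
Qed.

(** Checked directly against the definition of [is_derive]: half of eps pays for linearizing g at p,
    the other half for linearizing the four curves at s. *)
Lemma C1_chain (D : R * R * R * R -> Prop) (g : R * R * R * R -> R)
    (c0 c1 c2 c3 : R -> R) (s d0 d1 d2 d3 : R) :
  open D -> C1_on D g -> D (c0 s, c1 s, c2 s, c3 s) ->
  is_derive c0 s d0 -> is_derive c1 s d1 -> is_derive c2 s d2 -> is_derive c3 s d3 ->
  is_derive (fun z => g (c0 z, c1 z, c2 z, c3 z)) s
    (gradient_form g (c0 s, c1 s, c2 s, c3 s) (d0, d1, d2, d3)).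
Proof.
  intros HD Hg Hp H0 H1 H2 H3.
  set (p := (c0 s, c1 s, c2 s, c3 s)) in *.
  assert (Hc : continuous (fun z => (c0 z, c1 z, c2 z, c3 z)) s).
  { repeat apply continuous_pair; eapply is_derive_continuous_R; eassumption. }
  split; [apply is_linear_scal_l |].
  intros x Hx eps.
  assert (Es : s = x) by (apply is_filter_lim_locally_unique; exact Hx). subst x.
  set (M := Rabs d0 + Rabs d1 + Rabs d2 + Rabs d3 + 4).
  assert (HM : 0 < M).
  { unfold M. generalize (Rabs_pos d0), (Rabs_pos d1), (Rabs_pos d2), (Rabs_pos d3). lra. }
  set (N := Rabs (partial At g p) + Rabs (partial A1 g p) + Rabs (partial A2 g p)
            + Rabs (partial A3 g p) + 1).
  assert (HN : 0 < N).
  { unfold N. generalize (Rabs_pos (partial At g p)), (Rabs_pos (partial A1 g p)),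
      (Rabs_pos (partial A2 g p)), (Rabs_pos (partial A3 g p)). lra. }
  assert (He1 : 0 < eps / (2 * M)) by (apply Rdiv_lt_0_compat; [apply cond_pos | lra]).
  (* The cap by 1 bounds the increment of each curve by (|d| + 1) |z - s|; [M] is the sum of these
     four factors. *)
  assert (He2 : 0 < Rmin 1 (eps / (2 * N))).
  { apply Rmin_glb_lt; [lra | apply Rdiv_lt_0_compat; [apply cond_pos | lra]]. }
  assert (Hinc : locally s (fun z : R =>
    Rabs (g (c0 z, c1 z, c2 z, c3 z) - g p - gradient_form g p
      (c0 z - c0 s, c1 z - c1 s, c2 z - c2 s, c3 z - c3 s))
    <= eps / (2 * M) * (Rabs (c0 z - c0 s) + Rabs (c1 z - c1 s)
      + Rabs (c2 z - c2 s) + Rabs (c3 z - c3 s)))).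
  { exact (Hc _ (C1_increment D g p (mkposreal _ He1) HD Hg Hp)). }
  assert (Q : forall (c : R -> R) (d : R), is_derive c s d -> locally s (fun z =>
     Rabs (c z - c s - d * (z - s)) <= Rmin 1 (eps / (2 * N)) * Rabs (z - s))).
  { intros c d [_ Hcd]. specialize (Hcd s (fun P H => H) (mkposreal _ He2)).
    revert Hcd. apply filter_imp. intros z Hz.
    unfold norm, minus, plus, opp, scal in Hz; simpl in Hz.
    unfold abs, mult in Hz; simpl in Hz.
    replace (c z - c s - d * (z - s)) with (c z + - c s + - ((z + - s) * d)) by ring.
    exact Hz. }
  generalize (filter_and _ _ Hinc (filter_and _ _ (filter_and _ _ (Q _ _ H0) (Q _ _ H1))
     (filter_and _ _ (Q _ _ H2) (Q _ _ H3)))).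
  apply filter_imp.
  enough (main : forall z : R,
    Rabs (g (c0 z, c1 z, c2 z, c3 z) - g p - gradient_form g p
      (c0 z - c0 s, c1 z - c1 s, c2 z - c2 s, c3 z - c3 s))
    <= eps / (2 * M) * (Rabs (c0 z - c0 s) + Rabs (c1 z - c1 s)
      + Rabs (c2 z - c2 s) + Rabs (c3 z - c3 s)) ->
    Rabs (c0 z - c0 s - d0 * (z - s)) <= Rmin 1 (eps / (2 * N)) * Rabs (z - s) ->
    Rabs (c1 z - c1 s - d1 * (z - s)) <= Rmin 1 (eps / (2 * N)) * Rabs (z - s) ->
    Rabs (c2 z - c2 s - d2 * (z - s)) <= Rmin 1 (eps / (2 * N)) * Rabs (z - s) ->
    Rabs (c3 z - c3 s - d3 * (z - s)) <= Rmin 1 (eps / (2 * N)) * Rabs (z - s) ->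
    Rabs (g (c0 z, c1 z, c2 z, c3 z) + - g p + - ((z + - s) * gradient_form g p (d0, d1, d2, d3)))
      <= eps * Rabs (z + - s)).
  { intros z [Hz [[Q0 Q1] [Q2 Q3]]]. exact (main z Hz Q0 Q1 Q2 Q3). }
  intros z Hz Q0 Q1 Q2 Q3.
  unfold gradient_form, coord in Hz.
  unfold gradient_form, coord. fold p.
  set (e2 := Rmin 1 (eps / (2 * N))) in *. set (e1 := eps / (2 * M)) in *.
  set (h := Rabs (z - s)) in *.
  assert (Hh : 0 <= h) by apply Rabs_pos.
  assert (Hl1 : e2 <= 1) by apply Rmin_l.
  assert (Hl2 : e2 <= eps / (2 * N)) by apply Rmin_r.
  assert (Hb : forall (c : R -> R) (d : R), Rabs (c z - c s - d * (z - s)) <= e2 * h ->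
     Rabs (c z - c s) <= (Rabs d + 1) * h).
  { intros c d Hcd.
    replace (c z - c s) with ((c z - c s - d * (z - s)) + d * (z - s)) by ring.
    eapply Rle_trans; [apply Rabs_triang |]. rewrite (Rabs_mult d). fold h.
    assert (e2 * h <= 1 * h) by (apply Rmult_le_compat_r; lra). lra. }
  assert (b0 := Hb _ _ Q0). assert (b1 := Hb _ _ Q1).
  assert (b2 := Hb _ _ Q2). assert (b3 := Hb _ _ Q3).
  assert (L : forall a r, Rabs r <= e2 * h -> Rabs (a * r) <= Rabs a * (e2 * h)).
  { intros a r Hr. rewrite Rabs_mult. apply Rmult_le_compat_l; [apply Rabs_pos | exact Hr]. }
  assert (l0 := L (partial At g p) _ Q0). assert (l1 := L (partial A1 g p) _ Q1).
  assert (l2 := L (partial A2 g p) _ Q2). assert (l3 := L (partial A3 g p) _ Q3).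
  assert (S1 : e1 * (Rabs (c0 z - c0 s) + Rabs (c1 z - c1 s) + Rabs (c2 z - c2 s)
     + Rabs (c3 z - c3 s)) <= eps / 2 * h).
  { apply Rle_trans with (e1 * (M * h)).
    - apply Rmult_le_compat_l; [lra |]. unfold M. lra.
    - right. unfold e1. field. lra. }
  assert (S2 : Rabs (partial At g p) * (e2 * h) + Rabs (partial A1 g p) * (e2 * h)
     + Rabs (partial A2 g p) * (e2 * h) + Rabs (partial A3 g p) * (e2 * h) <= eps / 2 * h).
  { apply Rle_trans with (N * (eps / (2 * N) * h)).
    - apply Rle_trans with (N * (e2 * h)).
      + unfold N. assert (0 <= e2 * h) by (apply Rmult_le_pos; lra). lra.
      + apply Rmult_le_compat_l; [lra |]. apply Rmult_le_compat_r; lra.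
    - right. field. lra. }
  apply Rabs_le_between in Hz. apply Rabs_le_between in l0. apply Rabs_le_between in l1.
  apply Rabs_le_between in l2. apply Rabs_le_between in l3.
  change (Rabs (z + - s)) with h.
  apply Rabs_le_between. split; lra.
Qed.

Lemma continuity_2d_pt_of_continuous (f : R -> R -> R) (x y : R) :
  continuous (fun z : R * R => f (fst z) (snd z)) (x, y) -> continuity_2d_pt f x y.
Proof. intros H. apply continuity_2d_pt_filterlim. exact H. Qed.

(** For distinct axes this is the two-variable [Schwarz] on the coordinate plane [c] through p; the
    facts before it translate derivatives of the slice [f] into partials of w along [c]. *)
Lemma partial_comm (D : R * R * R * R -> Prop) (w : R * R * R * R -> R) (p : R * R * R * R)
    (i j : axis) :
  open D -> C2_on D w -> D p -> partial i (partial j w) p = partial j (partial i w) p.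
Proof.
  intros HD [Hw1 Hw2] Hp.
  assert (key : i <> j -> partial i (partial j w) p = partial j (partial i w) p).
  { intros Hij.
    set (f := fun a b => w (set_coord i (set_coord j p b) a)).
    set (c := fun z : R * R => set_coord i (set_coord j p (snd z)) (fst z)).
    assert (Cc : forall z, continuous c z).
    { intros z. destruct p as [[[t x1] x2] x3]. destruct i, j; try congruence; unfold c; simpl;
      repeat apply continuous_pair; first [apply continuous_const | apply continuous_fst
        | apply continuous_snd]. }
    set (a0 := coord i p). set (b0 := coord j p).
    assert (c0 : c (a0, b0) = p).
    { destruct p as [[[t x1] x2] x3]. destruct i, j; try congruence; reflexivity. }
    assert (S1 : forall k g q, set_coord k (set_coord k q g) = set_coord k q).
    { intros k g [[[t x1] x2] x3]; destruct k; reflexivity. }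
    assert (S2 : forall g h q, set_coord i (set_coord j q g) h = set_coord j (set_coord i q h) g).
    { intros g h [[[t x1] x2] x3]; destruct i, j; try congruence; reflexivity. }
    assert (S3 : forall k g q, coord k (set_coord k q g) = g).
    { intros k g [[[t x1] x2] x3]; destruct k; reflexivity. }
    assert (S4 : forall g q, coord j (set_coord i q g) = coord j q).
    { intros g [[[t x1] x2] x3]; destruct i, j; try congruence; reflexivity. }
    assert (Di : forall a b, Derive (fun z => f z b) a = partial i w (c (a, b))).
    { intros a b. unfold partial, f, c; simpl. rewrite S1, S3. reflexivity. }
    assert (Dj : forall a b, Derive (fun z => f a z) b = partial j w (c (a, b))).
    { intros a b. unfold partial, f, c; simpl. rewrite S4, S3. apply Derive_ext. intros s.
      rewrite <- (S2 s a (set_coord j p b)), S1. reflexivity. }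
    assert (Ei : forall a b, ex_partial i w (c (a, b)) -> ex_derive (fun z => f z b) a).
    { intros a b. unfold ex_partial, f, c; simpl. rewrite S1, S3. auto. }
    assert (Ej : forall a b, ex_partial j w (c (a, b)) -> ex_derive (fun z => f a z) b).
    { intros a b. unfold ex_partial, f, c; simpl. rewrite S4, S3. apply ex_derive_ext. intros s.
      rewrite <- (S2 s a (set_coord j p b)), S1. reflexivity. }
    assert (Dij : forall a b, Derive (fun z => Derive (fun t => f z t) b) a
       = partial i (partial j w) (c (a, b))).
    { intros a b. rewrite (Derive_ext _ _ a (fun z => Dj z b)).
      unfold partial at 2, c; simpl. rewrite S1, S3. reflexivity. }
    assert (Dji : forall a b, Derive (fun z => Derive (fun t => f t z) a) b
       = partial j (partial i w) (c (a, b))).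
    { intros a b. rewrite (Derive_ext _ _ b (fun z => Di a z)).
      unfold partial at 2, c; simpl. rewrite S4, S3. apply Derive_ext. intros s.
      rewrite <- (S2 s a (set_coord j p b)), S1. reflexivity. }
    assert (Eij : forall a b, ex_partial i (partial j w) (c (a, b)) ->
       ex_derive (fun z => Derive (fun t => f z t) b) a).
    { intros a b. unfold ex_partial, c; simpl. rewrite S1, S3. apply ex_derive_ext. intros s.
      symmetry. apply Dj. }
    assert (Eji : forall a b, ex_partial j (partial i w) (c (a, b)) ->
       ex_derive (fun z => Derive (fun t => f t z) a) b).
    { intros a b. unfold ex_partial, c; simpl. rewrite S4, S3. apply ex_derive_ext. intros s.
      rewrite Di. unfold c; simpl.
      rewrite <- (S2 s a (set_coord j p b)), S1. reflexivity. }
    rewrite <- c0, <- Dij, <- Dji.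
    assert (HDc : locally (a0, b0) (fun z => D (c z))).
    { apply (Cc (a0, b0)). rewrite c0. exact (HD p Hp). }
    apply Schwarz.
    - destruct HDc as [e He]. exists e. intros u v Hu Hv.
      assert (Dc : D (c (u, v))) by (apply He; split; [exact Hu | exact Hv]).
      repeat split.
      + apply Ei. apply (proj1 (Hw1 _ Dc i)).
      + apply Ej. apply (proj1 (Hw1 _ Dc j)).
      + apply Eij. apply (proj1 (Hw2 j _ Dc i)).
      + apply Eji. apply (proj1 (Hw2 i _ Dc j)).
    - apply continuity_2d_pt_ext with (fun a b => partial i (partial j w) (c (a, b))).
      { intros; symmetry; apply Dij. }
      apply continuity_2d_pt_of_continuous.
      apply (continuous_ext (fun z => partial i (partial j w) (c z))).
      { intros [a b]; reflexivity. }
      apply (continuous_comp c (partial i (partial j w))); [apply Cc |].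
      rewrite c0. apply (proj2 (Hw2 j p Hp i)).
    - apply continuity_2d_pt_ext with (fun a b => partial j (partial i w) (c (a, b))).
      { intros; symmetry; apply Dji. }
      apply continuity_2d_pt_of_continuous.
      apply (continuous_ext (fun z => partial j (partial i w) (c z))).
      { intros [a b]; reflexivity. }
      apply (continuous_comp c (partial j (partial i w))); [apply Cc |].
      rewrite c0. apply (proj2 (Hw2 i p Hp j)). }
  destruct i, j; try reflexivity; apply key; discriminate.
Qed.

(** * Integrals depending on a parameter *)


(** Each z has a radius within which g stays close to its value at (x0, z), and compactness of
    [a, b] gives a common one, so the integrands are uniformly close. The parameter space is general
    because iterated integrals need a parameter in R * R. *)
Lemma RInt_param_continuous {T : UniformSpace} (g : T -> R -> R) (a b : R) (x0 : T) :
  a <= b ->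
  (forall z, a <= z <= b -> continuous (fun p : T * R => g (fst p) (snd p)) (x0, z)) ->
  locally x0 (fun x => ex_RInt (g x) a b) ->
  continuous (fun x => RInt (g x) a b) x0.
Proof.
  intros Hab Hg Hex P [eps HP].
  set (eta := eps / (4 * (b - a + 1))).
  assert (Heta : 0 < eta) by (apply Rdiv_lt_0_compat; [apply cond_pos | lra]).
  assert (Hd : forall z, { d : posreal | a <= z <= b -> forall x z', ball x0 d x ->
     Rabs (z' - z) < d -> Rabs (g x z' - g x0 z) < eta }).
  { intros z. apply constructive_indefinite_description.
    destruct (classic (a <= z <= b)) as [Hz | Hz].
    - destruct (Hg z Hz _ (locally_ball (g x0 z) (mkposreal _ Heta))) as [d Hd].
      exists d. intros _ x z' Hx Hz'. apply (Hd (x, z')). split; assumption.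
    - exists (mkposreal 1 Rlt_0_1). intros H. contradiction. }
  destruct (compactness_value_1d a b (fun z => proj1_sig (Hd z))) as [d Hcd].
  assert (Hu : forall x, ball x0 d x -> forall z, a <= z <= b ->
     Rabs (g x z - g x0 z) <= 2 * eta).
  { intros x Hx z Hz. apply NNPP. intros Hn. apply (Hcd z Hz). intros [t [Ht [Htz Hdt]]].
    apply Hn. destruct (Hd t) as [dt Hdt']. simpl in Htz, Hdt.
    assert (K1 := Hdt' Ht x z (ball_le x0 d dt Hdt x Hx) Htz).
    assert (K2 := Hdt' Ht x0 z (ball_center x0 dt) Htz).
    apply Rabs_def2 in K1. apply Rabs_def2 in K2. apply Rabs_le_between. split; lra. }
  unfold filtermap. generalize (filter_and _ _ Hex (locally_ball x0 d)). apply filter_imp.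
  intros x [Hx1 Hx2]. apply HP.
  assert (H0 := locally_singleton _ _ Hex).
  change (Rabs (minus (RInt (g x) a b) (RInt (g x0) a b)) < eps).
  rewrite <- RInt_minus by assumption.
  apply Rle_lt_trans with ((b - a) * (2 * eta)).
  - apply (abs_RInt_le_const (fun z => minus (g x z) (g x0 z)) a b (2 * eta) Hab).
    + apply @ex_RInt_minus; assumption.
    + intros z Hz. exact (Hu x Hx2 z Hz).
  - unfold eta. apply Rle_lt_trans with (eps / 2 * ((b - a) / (b - a + 1))).
    + right. field. lra.
    + apply Rle_lt_trans with (eps / 2 * 1).
      * apply Rmult_le_compat_l; [generalize (cond_pos eps); lra |].
        apply Rle_div_l; lra.
      * generalize (cond_pos eps); lra.
Qed.

Lemma RInt_param_derive (f df : R -> R -> R) (a b x : R) :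
  a <= b ->
  locally x (fun y => forall z, is_derive (fun u => f u z) y (df y z)) ->
  (forall z, a <= z <= b -> continuous (fun p : R * R => df (fst p) (snd p)) (x, z)) ->
  locally x (fun y => ex_RInt (f y) a b) ->
  is_derive (fun y => RInt (f y) a b) x (RInt (df x) a b).
Proof.
  intros Hab Hd Hc Hex.
  replace (RInt (df x) a b) with (RInt (fun t => Derive (fun u => f u t) x) a b).
  - apply (is_derive_RInt_param f a b x).
    + revert Hd. apply filter_imp. intros y Hy t _. exists (df y t). apply Hy.
    + intros t Ht. rewrite Rmin_left, Rmax_right in Ht by exact Hab.
      apply continuity_2d_pt_ext_loc with df.
      * destruct Hd as [d Hd]. exists d. intros u v Hu _. symmetry. apply is_derive_unique.
        apply Hd. exact Hu.
      * apply continuity_2d_pt_of_continuous. exact (Hc t Ht).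
    + exact Hex.
  - apply RInt_ext. intros z _. apply is_derive_unique. exact (locally_singleton _ _ Hd z).
Qed.

(** * Integration over the sphere *)


(** The area weight sin th is left to the integrand: total derivatives in the angles can then be
    integrated without dividing by sin th. *)
Definition sphere_integral (h : R -> R -> R) : R :=
  RInt (fun phi => RInt (h phi) 0 PI) 0 (2 * PI).

Definition continuous2 (h : R -> R -> R) : Prop :=
  forall phi th, continuous (fun q : R * R => h (fst q) (snd q)) (phi, th).

Definition continuous3 (A : R -> R -> R -> R) (r : R) : Prop :=
  forall phi th,
    continuous (fun q : R * R * R => A (fst (fst q)) (snd (fst q)) (snd q)) (r, phi, th).

Lemma continuous2_r (h : R -> R -> R) (phi th : R) : continuous2 h -> continuous (h phi) th.
Proof.
  intros H. apply (continuous_comp (fun z => (phi, z)) (fun q : R * R => h (fst q) (snd q))).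
  - apply continuous_pair; [apply continuous_const | apply continuous_id].
  - apply H.
Qed.

Lemma continuous3_2 (A : R -> R -> R -> R) (r : R) : continuous3 A r -> continuous2 (A r).
Proof.
  intros H phi th.
  apply (continuous_comp (fun q : R * R => (r, fst q, snd q))
    (fun q : R * R * R => A (fst (fst q)) (snd (fst q)) (snd q))).
  - repeat apply continuous_pair;
      [apply continuous_const | apply continuous_fst | apply continuous_snd].
  - apply H.
Qed.

Lemma ex_RInt_continuous_R (f : R -> R) (a b : R) : (forall z, continuous f z) -> ex_RInt f a b.
Proof. intros H. apply (ex_RInt_continuous f). intros z _. apply H. Qed.

Lemma inner_continuous (h : R -> R -> R) (phi : R) :
  continuous2 h -> continuous (fun phi => RInt (h phi) 0 PI) phi.
Proof.
  intros H. apply RInt_param_continuous.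
  - generalize PI_RGT_0; lra.
  - intros z _. apply H.
  - apply filter_forall. intros x. apply ex_RInt_continuous_R. intros z.
    apply continuous2_r, H.
Qed.

Lemma sphere_integral_ext (f g : R -> R -> R) :
  (forall phi th, f phi th = g phi th) -> sphere_integral f = sphere_integral g.
Proof. intros H. apply RInt_ext. intros phi _. apply RInt_ext. intros th _. apply H. Qed.

Lemma sphere_integral_plus (f g : R -> R -> R) :
  continuous2 f -> continuous2 g ->
  sphere_integral (fun phi th => f phi th + g phi th) = sphere_integral f + sphere_integral g.
Proof.
  intros Hf Hg. unfold sphere_integral.
  rewrite <- (RInt_plus (V := R_CompleteNormedModule)).
  - apply RInt_ext. intros phi _. apply (RInt_plus (V := R_CompleteNormedModule));
    apply ex_RInt_continuous_R; intros z; apply continuous2_r; assumption.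
  - apply ex_RInt_continuous_R. intros z. apply inner_continuous, Hf.
  - apply ex_RInt_continuous_R. intros z. apply inner_continuous, Hg.
Qed.

Lemma sphere_integral_scal (k : R) (f : R -> R -> R) :
  continuous2 f -> sphere_integral (fun phi th => k * f phi th) = k * sphere_integral f.
Proof.
  intros Hf. unfold sphere_integral.
  rewrite <- (RInt_scal (V := R_CompleteNormedModule) (fun phi => RInt (f phi) 0 PI)).
  - apply RInt_ext. intros phi _. apply (RInt_scal (V := R_CompleteNormedModule) (f phi)).
    apply ex_RInt_continuous_R. intros z. apply continuous2_r, Hf.
  - apply ex_RInt_continuous_R. intros z. apply inner_continuous, Hf.
Qed.

Lemma sphere_integral_nonneg (f : R -> R -> R) :
  continuous2 f -> (forall phi th, 0 <= th <= PI -> 0 <= f phi th) -> 0 <= sphere_integral f.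
Proof.
  intros Hc Hf. assert (HP := PI_RGT_0). apply RInt_ge_0.
  - lra.
  - apply ex_RInt_continuous_R. intros z. apply inner_continuous, Hc.
  - intros phi _. apply RInt_ge_0; [lra | |].
    + apply ex_RInt_continuous_R. intros z. apply continuous2_r, Hc.
    + intros th Hth. apply Hf. lra.
Qed.

Lemma sphere_integral_sin (c : R) : sphere_integral (fun _ th => sin th * c) = 4 * PI * c.
Proof.
  unfold sphere_integral.
  assert (E : RInt (fun th => sin th * c) 0 PI = 2 * c).
  { apply is_RInt_unique.
    replace (2 * c) with (minus (- cos PI * c) (- cos 0 * c)).
    - apply (is_RInt_derive (fun th => - cos th * c) (fun th => sin th * c)).
      + intros x _. auto_derive; [exact I | ring].
      + intros x _. apply (continuous_mult (fun x => sin x) (fun _ => c)).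
        * apply continuous_sin.
        * apply continuous_const.
    - change (- cos PI * c + - (- cos 0 * c) = 2 * c). rewrite cos_PI, cos_0. ring. }
  rewrite (RInt_ext _ (fun _ => 2 * c)) by (intros; exact E).
  rewrite RInt_const. change ((2 * PI - 0) * (2 * c) = 4 * PI * c). ring.
Qed.

Lemma RInt_is_derive (f df : R -> R) (a b : R) :
  (forall x, is_derive f x (df x)) -> (forall x, continuous df x) -> RInt df a b = f b - f a.
Proof.
  intros Hd Hc. apply is_RInt_unique. apply (is_RInt_derive f df); intros; auto.
Qed.

(** With [sphere_integral_dphi] this replaces the divergence theorem on the sphere: there is no
    boundary term at the poles, where B vanishes, and none in phi by periodicity. *)
Lemma sphere_integral_dth (B dB : R -> R -> R) :
  continuous2 dB -> (forall phi th, is_derive (B phi) th (dB phi th)) ->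
  (forall phi, B phi 0 = 0) -> (forall phi, B phi PI = 0) -> sphere_integral dB = 0.
Proof.
  intros Hc Hd H0 HP. unfold sphere_integral.
  rewrite (RInt_ext _ (fun _ => 0)).
  - rewrite RInt_const. change ((2 * PI - 0) * 0 = 0). ring.
  - intros phi _. rewrite (RInt_is_derive (B phi)).
    + change (B phi PI - B phi 0 = 0). rewrite H0, HP. ring.
    + apply Hd.
    + intros x. apply continuous2_r, Hc.
Qed.

Lemma sphere_integral_dphi (C dC : R -> R -> R) :
  continuous2 C -> continuous2 dC ->
  (forall phi th, is_derive (fun z => C z th) phi (dC phi th)) ->
  (forall th, C (2 * PI) th = C 0 th) -> sphere_integral dC = 0.
Proof.
  intros HcC Hc Hd Hper. unfold sphere_integral.
  rewrite (RInt_is_derive (fun phi => RInt (C phi) 0 PI)).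
  - rewrite (RInt_ext (C (2 * PI)) (C 0)) by (intros; apply Hper).
    apply (Rminus_diag_eq (RInt (C 0) 0 PI)). reflexivity.
  - intros phi. apply RInt_param_derive.
    + generalize PI_RGT_0; lra.
    + apply filter_forall. intros y z. apply Hd.
    + intros z _. apply Hc.
    + apply filter_forall. intros y. apply ex_RInt_continuous_R. intros z.
      apply continuous2_r, HcC.
  - intros x. apply inner_continuous, Hc.
Qed.

Lemma inner_continuous2 (A : R -> R -> R -> R) (r phi : R) :
  locally r (continuous3 A) ->
  continuous (fun q : R * R => RInt (A (fst q) (snd q)) 0 PI) (r, phi).
Proof.
  intros H.
  apply (RInt_param_continuous (fun (q : R * R) th => A (fst q) (snd q) th)).
  - generalize PI_RGT_0; lra.
  - intros z _. apply (locally_singleton _ _ H).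
  - destruct H as [d Hd]. exists d. intros [y psi] [Hy _].
    apply ex_RInt_continuous_R. intros z. apply (continuous2_r (A y) psi z).
    apply continuous3_2, Hd, Hy.
Qed.

Lemma sphere_integral_continuous (A : R -> R -> R -> R) (r : R) :
  locally r (continuous3 A) -> continuous (fun s => sphere_integral (A s)) r.
Proof.
  intros H.
  apply (RInt_param_continuous (fun s phi => RInt (A s phi) 0 PI)).
  - generalize PI_RGT_0; lra.
  - intros z _. apply inner_continuous2, H.
  - revert H. apply filter_imp. intros y Hy. apply ex_RInt_continuous_R. intros z.
    apply inner_continuous, continuous3_2, Hy.
Qed.

Lemma sphere_integral_derive (A dA : R -> R -> R -> R) (r : R) :
  locally r (continuous3 A) -> locally r (continuous3 dA) ->
  locally r (fun s => forall phi th, is_derive (fun z => A z phi th) s (dA s phi th)) ->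
  is_derive (fun s => sphere_integral (A s)) r (sphere_integral (dA r)).
Proof.
  intros HA HdA Hd. assert (HP := PI_RGT_0).
  apply (RInt_param_derive (fun s phi => RInt (A s phi) 0 PI)
           (fun s phi => RInt (dA s phi) 0 PI)).
  - lra.
  - generalize (filter_and _ _ (locally_locally _ _ HA)
      (filter_and _ _ (locally_locally _ _ HdA) (locally_locally _ _ Hd))).
    apply filter_imp. intros y [Hy1 [Hy2 Hy3]] phi.
    apply (RInt_param_derive (fun s th => A s phi th) (fun s th => dA s phi th)).
    + lra.
    + revert Hy3. apply filter_imp. intros s Hs z. apply Hs.
    + intros z _.
      apply (continuous_comp (fun q : R * R => (fst q, phi, snd q))
        (fun q : R * R * R => dA (fst (fst q)) (snd (fst q)) (snd q))).
      * repeat apply continuous_pair;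
        [apply continuous_fst | apply continuous_const | apply continuous_snd].
      * apply (locally_singleton _ _ Hy2).
    + revert Hy1. apply filter_imp. intros s Hs. apply ex_RInt_continuous_R. intros z.
      apply continuous2_r, continuous3_2, Hs.
  - intros z _. apply inner_continuous2, HdA.
  - revert HA. apply filter_imp. intros y Hy. apply ex_RInt_continuous_R. intros z.
    apply inner_continuous, continuous3_2, Hy.
Qed.

(** * Integrals over backward light cones *)


Lemma continuous_Rplus {T : UniformSpace} (f g : T -> R) (x : T) :
  continuous f x -> continuous g x -> continuous (fun y => f y + g y) x.
Proof. apply (continuous_plus (V := R_NormedModule)). Qed.

Lemma continuous_Ropp {T : UniformSpace} (f : T -> R) (x : T) :
  continuous f x -> continuous (fun y => - f y) x.
Proof. apply (continuous_opp (V := R_NormedModule)). Qed.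

Lemma continuous_Rminus {T : UniformSpace} (f g : T -> R) (x : T) :
  continuous f x -> continuous g x -> continuous (fun y => f y - g y) x.
Proof. apply (continuous_minus (V := R_NormedModule)). Qed.

Lemma continuous_Rmult {T : UniformSpace} (f g : T -> R) (x : T) :
  continuous f x -> continuous g x -> continuous (fun y => f y * g y) x.
Proof. apply (continuous_mult (K := R_AbsRing)). Qed.

Lemma continuous_Rcomp {T : UniformSpace} (f : T -> R) (g : R -> R) (x : T) :
  (forall y, continuous g y) -> continuous f x -> continuous (fun y => g (f y)) x.
Proof. intros Hg Hf. apply (continuous_comp f g); [exact Hf | apply Hg]. Qed.

Ltac cont :=
  lazymatch goal with
  | |- continuous (fun _ => ?c) _ => apply continuous_const
  | |- continuous (fun y => (@?f y, @?g y)) _ => apply (continuous_pair f g); cont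
  | |- continuous (fun y => @?f y + @?g y) _ => apply (continuous_Rplus f g); cont
  | |- continuous (fun y => @?f y - @?g y) _ => apply (continuous_Rminus f g); cont
  | |- continuous (fun y => @?f y * @?g y) _ => apply (continuous_Rmult f g); cont
  | |- continuous (fun y => - @?f y) _ => apply (continuous_Ropp f); cont
  | |- continuous (fun y => sin (@?f y)) _ =>
      apply (continuous_Rcomp f sin); [apply continuous_sin | cont]
  | |- continuous (fun y => cos (@?f y)) _ =>
      apply (continuous_Rcomp f cos); [apply continuous_cos | cont]
  | |- continuous (fun y => fst (fst y)) _ =>
      apply (continuous_comp fst fst); apply continuous_fst
  | |- continuous (fun y => snd (fst y)) _ =>
      apply (continuous_comp fst snd); [apply continuous_fst | apply continuous_snd]
  | |- continuous (fun y => fst y) _ => apply continuous_fst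
  | |- continuous (fun y => snd y) _ => apply continuous_snd
  | |- continuous (fun y => y) _ => apply continuous_id
  | |- _ => idtac
  end.

Lemma open_time_gt (T : R) : open (fun q : R * R * R * R => T < time q).
Proof.
  intros [[[t x1] x2] x3] H. apply locally_R4. simpl in H.
  assert (Hd : 0 < t - T) by lra. exists (mkposreal _ Hd). simpl.
  intros t' y1 y2 y3 H0 _ _ _. apply Rabs_def2 in H0. lra.
Qed.

Definition cone_point (p : R * R * R * R) (r phi th : R) : R * R * R * R :=
  let '(t, x1, x2, x3) := p in
  (t - r, x1 + r * (sin th * cos phi), x2 + r * (sin th * sin phi), x3 + r * cos th).

(* For G the gradient of g this is sin th * (g + r (d_t g + d_omega g)), so that its
   integral over the angles is 4 pi (d_r + d_t) (r times the spherical mean of g). *)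
Definition cone_density (g : R * R * R * R -> R) (G : axis -> R * R * R * R -> R)
    (p : R * R * R * R) (r phi th : R) : R :=
  let q := cone_point p r phi th in
  sin th * (g q + r * (G At q + sin th * cos phi * G A1 q + sin th * sin phi * G A2 q
    + cos th * G A3 q)).

(** [G] is a separate argument because [comparison] applies this to the extension by zero of u, with
    [G] the extensions by zero of its partial derivatives. *)
Definition cone_integral (g : R * R * R * R -> R) (G : axis -> R * R * R * R -> R)
    (p : R * R * R * R) (r : R) : R :=
  sphere_integral (cone_density g G p r).

Lemma time_cone_point (p : R * R * R * R) (r phi th : R) :
  time (cone_point p r phi th) = time p - r.
Proof. destruct p as [[[t x1] x2] x3]; reflexivity. Qed.

Lemma cone_point_continuous (p : R * R * R * R) (q : R * R * R) :
  continuous (fun q : R * R * R => cone_point p (fst (fst q)) (snd (fst q)) (snd q)) q.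
Proof.
  destruct p as [[[t x1] x2] x3]. unfold cone_point.
  cont.
Qed.

Lemma comp_cone_continuous (g : R * R * R * R -> R) (p : R * R * R * R) (r phi th : R) :
  (forall q, time q = time p - r -> continuous g q) ->
  continuous (fun q : R * R * R => g (cone_point p (fst (fst q)) (snd (fst q)) (snd q)))
    (r, phi, th).
Proof.
  intros H. apply (continuous_comp
    (fun q : R * R * R => cone_point p (fst (fst q)) (snd (fst q)) (snd q)) g).
  - apply cone_point_continuous.
  - apply H. apply time_cone_point.
Qed.

Lemma cone_density_continuous (g : R * R * R * R -> R) (G : axis -> R * R * R * R -> R)
    (p : R * R * R * R) (r : R) :
  (forall q, time q = time p - r -> continuous g q) ->
  (forall i q, time q = time p - r -> continuous (G i) q) ->
  continuous3 (cone_density g G p) r.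
Proof.
  intros Hg HG phi th. unfold cone_density.
  assert (Cg := comp_cone_continuous g p r phi th Hg).
  assert (CG := fun i => comp_cone_continuous (G i) p r phi th (HG i)).
  cont; solve [apply Cg | apply CG].
Qed.

Lemma cone_integral_continuous (g : R * R * R * R -> R) (G : axis -> R * R * R * R -> R)
    (p : R * R * R * R) (r : R) :
  locally r (fun s => forall q, time q = time p - s -> continuous g q /\
    forall i, continuous (G i) q) ->
  continuous (cone_integral g G p) r.
Proof.
  intros H. apply sphere_integral_continuous. revert H. apply filter_imp.
  intros s Hs. apply cone_density_continuous; intros; apply Hs; assumption.
Qed.

Lemma cone_integral_0 (g : R * R * R * R -> R) (G : axis -> R * R * R * R -> R)
    (p : R * R * R * R) :
  cone_integral g G p 0 = 4 * PI * g p.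
Proof.
  rewrite <- sphere_integral_sin. apply sphere_integral_ext. intros phi th.
  unfold cone_density.
  replace (cone_point p 0 phi th) with p; [ring |].
  destruct p as [[[t x1] x2] x3]. unfold cone_point.
  repeat f_equal; ring.
Qed.

Lemma cone_chain_r (T : R) (g : R * R * R * R -> R) (p : R * R * R * R) (r phi th : R) :
  C1_on (fun q => T < time q) g -> T < time p - r ->
  is_derive (fun s => g (cone_point p s phi th)) r
    (gradient_form g (cone_point p r phi th)
       (-1, sin th * cos phi, sin th * sin phi, cos th)).
Proof.
  intros Hg Ht. destruct p as [[[t x1] x2] x3]. unfold cone_point.
  apply (C1_chain (fun q => T < time q) g (fun s => t - s)
    (fun s => x1 + s * (sin th * cos phi)) (fun s => x2 + s * (sin th * sin phi))
    (fun s => x3 + s * cos th)); try assumption; try apply open_time_gt;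
    auto_derive; trivial; ring.
Qed.

Lemma cone_chain_th (T : R) (g : R * R * R * R -> R) (p : R * R * R * R) (r phi th : R) :
  C1_on (fun q => T < time q) g -> T < time p - r ->
  is_derive (fun s => g (cone_point p r phi s)) th
    (gradient_form g (cone_point p r phi th)
       (0, r * (cos th * cos phi), r * (cos th * sin phi), - r * sin th)).
Proof.
  intros Hg Ht. destruct p as [[[t x1] x2] x3]. unfold cone_point.
  apply (C1_chain (fun q => T < time q) g (fun s => t - r)
    (fun s => x1 + r * (sin s * cos phi)) (fun s => x2 + r * (sin s * sin phi))
    (fun s => x3 + r * cos s)); try assumption; try apply open_time_gt;
    auto_derive; trivial; ring.
Qed.

Lemma cone_chain_phi (T : R) (g : R * R * R * R -> R) (p : R * R * R * R) (r phi th : R) :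
  C1_on (fun q => T < time q) g -> T < time p - r ->
  is_derive (fun s => g (cone_point p r s th)) phi
    (gradient_form g (cone_point p r phi th)
       (0, - r * (sin th * sin phi), r * (sin th * cos phi), 0)).
Proof.
  intros Hg Ht. destruct p as [[[t x1] x2] x3]. unfold cone_point.
  apply (C1_chain (fun q => T < time q) g (fun s => t - r)
    (fun s => x1 + r * (sin th * cos s)) (fun s => x2 + r * (sin th * sin s))
    (fun s => x3 + r * cos th)); try assumption; try apply open_time_gt;
    auto_derive; trivial; ring.
Qed.

Lemma is_derive_unique_eta (f : R -> R) (x l : R) :
  is_derive f x l -> Derive (fun z : R => f z) x = l.
Proof. exact (is_derive_unique f x l). Qed.

(** Stated for abstract functions, so that [auto_derive] only sees the explicit factors. The polar
    and azimuthal versions below serve the same purpose. *)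
Lemma is_derive_radial_combination (f f0 f1 f2 f3 : R -> R) (e a b c r d d0 d1 d2 d3 : R) :
  is_derive f r d -> is_derive f0 r d0 -> is_derive f1 r d1 -> is_derive f2 r d2 ->
  is_derive f3 r d3 ->
  is_derive (fun z => e * (f z + z * (f0 z + a * f1 z + b * f2 z + c * f3 z))) r
    (e * (d + (f0 r + a * f1 r + b * f2 r + c * f3 r)
      + r * (d0 + a * d1 + b * d2 + c * d3))).
Proof.
  intros H H0 H1 H2 H3. auto_derive.
  - repeat split; eexists; eassumption.
  - rewrite (is_derive_unique_eta f _ _ H), (is_derive_unique_eta f0 _ _ H0),
      (is_derive_unique_eta f1 _ _ H1), (is_derive_unique_eta f2 _ _ H2),
      (is_derive_unique_eta f3 _ _ H3).
    ring.
Qed.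

Lemma is_derive_polar_combination (f1 f2 f3 : R -> R) (a b th d1 d2 d3 : R) :
  is_derive f1 th d1 -> is_derive f2 th d2 -> is_derive f3 th d3 ->
  is_derive (fun z => sin z * (cos z * a * f1 z + cos z * b * f2 z - sin z * f3 z)) th
    (cos th * (cos th * a * f1 th + cos th * b * f2 th - sin th * f3 th)
     + sin th * (- sin th * a * f1 th - sin th * b * f2 th - cos th * f3 th
       + cos th * a * d1 + cos th * b * d2 - sin th * d3)).
Proof.
  intros H1 H2 H3. auto_derive.
  - repeat split; eexists; eassumption.
  - rewrite (is_derive_unique_eta f1 _ _ H1), (is_derive_unique_eta f2 _ _ H2),
      (is_derive_unique_eta f3 _ _ H3). ring.
Qed.

Lemma is_derive_azimuthal_combination (f1 f2 : R -> R) (phi d1 d2 : R) :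
  is_derive f1 phi d1 -> is_derive f2 phi d2 ->
  is_derive (fun z => - sin z * f1 z + cos z * f2 z) phi
    (- cos phi * f1 phi - sin phi * f2 phi - sin phi * d1 + cos phi * d2).
Proof.
  intros H1 H2. auto_derive.
  - repeat split; eexists; eassumption.
  - rewrite (is_derive_unique_eta f1 _ _ H1), (is_derive_unique_eta f2 _ _ H2). ring.
Qed.

Lemma Box_density_continuous (T : R) (w : R * R * R * R -> R) (p : R * R * R * R) (r : R) :
  C2_on (fun q => T < time q) w -> T < time p - r ->
  continuous2 (fun phi th => sin th * Box w (cone_point p r phi th)).
Proof.
  intros [_ Hw2] Hr.
  assert (q2 : forall i j,
     continuous2 (fun phi th => partial i (partial j w) (cone_point p r phi th))).
  { intros i j.
    apply (continuous3_2 (fun s phi th => partial i (partial j w) (cone_point p s phi th))).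
    intros phi th. apply (comp_cone_continuous (partial i (partial j w)) p r phi th).
    intros q Hq. apply (Hw2 j q). rewrite Hq. exact Hr. }
  intros phi th. unfold Box. cont; lazymatch goal with
    | |- continuous (fun _ => partial ?i (partial ?j w) _) _ => exact (q2 i j phi th)
    end.
Qed.

(* With e_th, e_phi the unit vectors of spherical coordinates, the spherical Laplacian is
   sin th * Lap_S w = r (d_th (sin th e_th.grad w) + d_phi (e_phi.grad w)); in this form the
   coefficients have no singularity at the poles. *)
Lemma cone_integral_derive (T : R) (w : R * R * R * R -> R) (p : R * R * R * R) (r : R) :
  C2_on (fun q => T < time q) w -> T < time p - r ->
  is_derive (cone_integral w (fun i => partial i w) p) r
    (r * sphere_integral (fun phi th => sin th * Box w (cone_point p r phi th))).
Proof.
  intros [Hw1 Hw2] Hr.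
  set (DT := fun q : R * R * R * R => T < time q) in *.
  assert (HDT : open DT) by apply open_time_gt.
  set (G := fun g r phi th => gradient_form g (cone_point p r phi th)
       (-1, sin th * cos phi, sin th * sin phi, cos th)).
  (* The two first-order time derivatives cancel, and so do the mixed second ones once partials
     commute. What remains is sin th (2 d_omega w + r (d_omega^2 w - d_t^2 w)). *)
  set (dA := fun r phi th => sin th * (G w r phi th
     + (partial At w (cone_point p r phi th) + sin th * cos phi * partial A1 w (cone_point p r phi th)
        + sin th * sin phi * partial A2 w (cone_point p r phi th)
        + cos th * partial A3 w (cone_point p r phi th))
     + r * (G (partial At w) r phi th + sin th * cos phi * G (partial A1 w) r phi th
        + sin th * sin phi * G (partial A2 w) r phi th + cos th * G (partial A3 w) r phi th))).
  assert (Hloc : locally r (fun s => T < time p - s)).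
  { assert (Hd : 0 < time p - r - T) by lra. exists (mkposreal _ Hd). intros s Hs.
    change (Rabs (s - r) < time p - r - T) in Hs. apply Rabs_def2 in Hs. lra. }
  assert (CP : forall s, T < time p - s -> forall phi th, DT (cone_point p s phi th)).
  { intros s Hs phi th. unfold DT. rewrite time_cone_point. exact Hs. }
  assert (K0 : forall s, T < time p - s -> forall q, time q = time p - s -> DT q).
  { intros s Hs q Hq. unfold DT. rewrite Hq. exact Hs. }
  assert (c0 : forall s, T < time p - s -> forall q, time q = time p - s -> continuous w q).
  { intros s Hs q Hq. apply (C1_on_continuous DT); eauto. }
  assert (c1 : forall s, T < time p - s -> forall i q, time q = time p - s ->
     continuous (partial i w) q).
  { intros s Hs i q Hq. apply (Hw1 q (K0 s Hs q Hq) i). }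
  assert (c2 : forall s, T < time p - s -> forall i j q, time q = time p - s ->
     continuous (partial i (partial j w)) q).
  { intros s Hs i j q Hq. apply (Hw2 j q (K0 s Hs q Hq) i). }
  assert (CA : forall s, T < time p - s ->
     continuous3 (cone_density w (fun i => partial i w) p) s).
  { intros s Hs. apply cone_density_continuous; eauto. }
  assert (CdA : forall s, T < time p - s -> continuous3 dA s).
  { intros s Hs phi th.
    assert (C1 := fun i => comp_cone_continuous (partial i w) p s phi th (c1 s Hs i)).
    assert (C2 := fun i j => comp_cone_continuous (partial i (partial j w)) p s phi th
      (c2 s Hs i j)).
    unfold dA, G, gradient_form, coord.
    cont; lazymatch goal with
      | |- continuous (fun _ => partial ?i (partial ?j w) _) _ => exact (C2 i j)
      | |- continuous (fun _ => partial ?i w _) _ => exact (C1 i)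
      end. }
  assert (DA : forall s, T < time p - s -> forall phi th,
     is_derive (fun z => cone_density w (fun i => partial i w) p z phi th) s (dA s phi th)).
  { intros s Hs phi th.
    apply (is_derive_radial_combination (fun z => w (cone_point p z phi th))
      (fun z => partial At w (cone_point p z phi th))
      (fun z => partial A1 w (cone_point p z phi th))
      (fun z => partial A2 w (cone_point p z phi th))
      (fun z => partial A3 w (cone_point p z phi th)));
    apply (cone_chain_r T); auto. }
  replace (r * sphere_integral (fun phi th => sin th * Box w (cone_point p r phi th)))
    with (sphere_integral (dA r)).
  { apply sphere_integral_derive.
    - revert Hloc. apply filter_imp. exact CA.
    - revert Hloc. apply filter_imp. exact CdA.
    - revert Hloc. apply filter_imp. exact DA. }
  set (H := fun g phi th => gradient_form g (cone_point p r phi th)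
       (0, r * (cos th * cos phi), r * (cos th * sin phi), - r * sin th)).
  set (J := fun g phi th => gradient_form g (cone_point p r phi th)
       (0, - r * (sin th * sin phi), r * (sin th * cos phi), 0)).
  set (B := fun phi th => sin th * (cos th * cos phi * partial A1 w (cone_point p r phi th)
     + cos th * sin phi * partial A2 w (cone_point p r phi th)
     - sin th * partial A3 w (cone_point p r phi th))).
  set (dB := fun phi th => cos th * (cos th * cos phi * partial A1 w (cone_point p r phi th)
     + cos th * sin phi * partial A2 w (cone_point p r phi th)
     - sin th * partial A3 w (cone_point p r phi th))
     + sin th * (- sin th * cos phi * partial A1 w (cone_point p r phi th)
     - sin th * sin phi * partial A2 w (cone_point p r phi th)
     - cos th * partial A3 w (cone_point p r phi th)
     + cos th * cos phi * H (partial A1 w) phi th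
     + cos th * sin phi * H (partial A2 w) phi th - sin th * H (partial A3 w) phi th)).
  set (C := fun phi th => - sin phi * partial A1 w (cone_point p r phi th)
     + cos phi * partial A2 w (cone_point p r phi th)).
  set (dC := fun phi th => - cos phi * partial A1 w (cone_point p r phi th)
     - sin phi * partial A2 w (cone_point p r phi th)
     - sin phi * J (partial A1 w) phi th + cos phi * J (partial A2 w) phi th).
  assert (two : forall f : R -> R -> R -> R, continuous3 f r -> continuous2 (f r)).
  { intros f. apply continuous3_2. }
  assert (q1 : forall i, continuous2 (fun phi th => partial i w (cone_point p r phi th))).
  { intros i. apply (two (fun s phi th => partial i w (cone_point p s phi th))). intros phi th.
    exact (comp_cone_continuous (partial i w) p r phi th (c1 r Hr i)). }
  assert (q2 : forall i j, continuous2 (fun phi th => partial i (partial j w) (cone_point p r phi th))).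
  { intros i j. apply (two (fun s phi th => partial i (partial j w) (cone_point p s phi th))).
    intros phi th.
    exact (comp_cone_continuous (partial i (partial j w)) p r phi th (c2 r Hr i j)). }
  assert (CdB : continuous2 dB).
  { intros phi th. unfold dB, H, gradient_form, coord. cont; lazymatch goal with
      | |- continuous (fun _ => partial ?i (partial ?j w) _) _ => exact (q2 i j phi th)
      | |- continuous (fun _ => partial ?i w _) _ => exact (q1 i phi th)
      end. }
  assert (CC : continuous2 C).
  { intros phi th. unfold C. cont; lazymatch goal with
      | |- continuous (fun _ => partial ?i (partial ?j w) _) _ => exact (q2 i j phi th)
      | |- continuous (fun _ => partial ?i w _) _ => exact (q1 i phi th)
      end. }
  assert (CdC : continuous2 dC).
  { intros phi th. unfold dC, J, gradient_form, coord. cont; lazymatch goal with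
      | |- continuous (fun _ => partial ?i (partial ?j w) _) _ => exact (q2 i j phi th)
      | |- continuous (fun _ => partial ?i w _) _ => exact (q1 i phi th)
      end. }
  assert (IB : sphere_integral dB = 0).
  { apply (sphere_integral_dth B).
    - exact CdB.
    - intros phi th.
      apply (is_derive_polar_combination (fun z => partial A1 w (cone_point p r phi z))
        (fun z => partial A2 w (cone_point p r phi z))
        (fun z => partial A3 w (cone_point p r phi z)));
      apply (cone_chain_th T); auto.
    - intros phi. unfold B. rewrite sin_0. ring.
    - intros phi. unfold B. rewrite sin_PI. ring. }
  assert (IC : sphere_integral dC = 0).
  { apply (sphere_integral_dphi C).
    - exact CC.
    - exact CdC.
    - intros phi th.
      apply (is_derive_azimuthal_combination (fun z => partial A1 w (cone_point p r z th))
        (fun z => partial A2 w (cone_point p r z th)));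
      apply (cone_chain_phi T); auto.
    - intros th. unfold C. destruct p as [[[t x1] x2] x3]. unfold cone_point.
      rewrite sin_2PI, cos_2PI, sin_0, cos_0. reflexivity. }
  rewrite <- sphere_integral_scal by exact (Box_density_continuous T w p r (conj Hw1 Hw2) Hr).
  (* What [dA] lacks to be r sin th Box w is (1/r) sin th Lap_S w, which is dB + dC. Both integrate
     to zero, so they may be added to the integrand; the remaining identity is pointwise and free of
     division by r, hence also valid at r = 0. *)
  assert (Sum : sphere_integral (fun phi th => dA r phi th + dB phi th + dC phi th)
     = sphere_integral (dA r)).
  { rewrite (sphere_integral_plus (fun phi th => dA r phi th + dB phi th) dC).
    - rewrite (sphere_integral_plus (dA r) dB), IB, IC; [ring | | exact CdB].
      apply two, CdA, Hr.
    - intros phi th. cont; [apply (two dA (CdA r Hr)) | apply CdB].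
    - exact CdC. }
  rewrite <- Sum. apply sphere_integral_ext. intros phi th.
  assert (Q := CP r Hr phi th).
  assert (s01 := partial_comm DT w _ At A1 HDT (conj Hw1 Hw2) Q).
  assert (s02 := partial_comm DT w _ At A2 HDT (conj Hw1 Hw2) Q).
  assert (s03 := partial_comm DT w _ At A3 HDT (conj Hw1 Hw2) Q).
  assert (s12 := partial_comm DT w _ A1 A2 HDT (conj Hw1 Hw2) Q).
  assert (s13 := partial_comm DT w _ A1 A3 HDT (conj Hw1 Hw2) Q).
  assert (s23 := partial_comm DT w _ A2 A3 HDT (conj Hw1 Hw2) Q).
  assert (tp : sin phi * sin phi = 1 - cos phi * cos phi).
  { generalize (sin2_cos2 phi). unfold Rsqr. lra. }
  assert (tt : sin th * sin th = 1 - cos th * cos th).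
  { generalize (sin2_cos2 th). unfold Rsqr. lra. }
  unfold dA, dB, dC, G, H, J, Box, gradient_form, coord.
  rewrite s01, s02, s03, s12, s13, s23.
  ring [tp tt].
Qed.

(** * Comparison principle *)


Lemma within_time_R4 (u : R * R * R * R -> R) (b : R -> Prop) (x0 x1 x2 x3 l : R) :
  filterlim u (within (fun q => b (time q)) (locally (x0, x1, x2, x3))) (locally l) ->
  forall eps, 0 < eps -> exists d, 0 < d /\ forall t y1 y2 y3, b t ->
    Rabs (t - x0) < d -> Rabs (y1 - x1) < d -> Rabs (y2 - x2) < d -> Rabs (y3 - x3) < d ->
    Rabs (u (t, y1, y2, y3) - l) < eps.
Proof.
  intros H eps He.
  assert (H1 := H _ (locally_ball l (mkposreal eps He))).
  unfold filtermap, within in H1. apply locally_R4 in H1. destruct H1 as [d Hd].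
  exists d. split; [apply cond_pos |]. intros t y1 y2 y3 Hb H0 Hy1 Hy2 Hy3.
  exact (Hd t y1 y2 y3 H0 Hy1 Hy2 Hy3 Hb).
Qed.

Lemma Rabs_le_all_eps (l k : R) : 0 < k -> (forall e, 0 < e -> Rabs l <= k * e) -> l = 0.
Proof.
  intros Hk H. apply NNPP. intros Hl. assert (Hp := Rabs_pos_lt l Hl).
  assert (He : 0 < Rabs l / (2 * k)) by (apply Rdiv_lt_0_compat; lra).
  specialize (H _ He). replace (k * (Rabs l / (2 * k))) with (Rabs l / 2) in H by (field; lra).
  lra.
Qed.

Lemma slope_small (l s a b e : R) :
  0 < s -> Rabs (b - a - l * s) <= e * s -> Rabs a <= e * s -> Rabs b <= e * s ->
  Rabs l <= 3 * e.
Proof.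
  intros Hs H Ha Hb.
  apply Rmult_le_reg_r with s; [exact Hs |].
  rewrite <- (Rabs_pos_eq s) at 1 by lra. rewrite <- Rabs_mult.
  apply Rabs_le_between in H. apply Rabs_le_between in Ha. apply Rabs_le_between in Hb.
  apply Rabs_le_between. split; lra.
Qed.

(** The regularity hypothesis provides a limit l of the derivative at the slice; only its value is
    in question. By the mean value inequality, increments of u over short segments in {t > 2} are
    close to l times the length, while the vanishing data make them small. *)
Lemma initial_gradient_zero (u : R * R * R * R -> R) (i : axis) (p : R * R * R * R) :
  classical_regularity u ->
  (forall x1 x2 x3, u (2, x1, x2, x3) = 0) ->
  (forall x1 x2 x3, is_initial_dt u x1 x2 x3 0) ->
  time p = 2 ->
  filterlim (partial i u) (within (fun q => 2 < time q) (locally p)) (locally 0).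
Proof.
  intros [[Hu1 _] [Hc Hlim]] Hu0 Hdt Hp.
  destruct (Hlim i p Hp) as [l Hl].
  enough (l = 0) by (subst l; exact Hl).
  destruct p as [[[t x1] x2] x3]. simpl in Hp. subst t.
  assert (small : forall y1 y2 y3 e, 0 < e -> exists d, 0 < d /\
     forall h, 0 < h < d -> Rabs (u (2 + h, y1, y2, y3)) <= e).
  { intros y1 y2 y3 e He.
    assert (H2 : 2 <= time (2, y1, y2, y3)) by (simpl; lra).
    destruct (within_time_R4 u (fun z => 2 <= z) 2 y1 y2 y3 _ (Hc _ H2) e He) as [d [Hd H]].
    exists d. split; [exact Hd |]. intros h Hh. rewrite Hu0 in H.
    left. replace (u (2 + h, y1, y2, y3)) with (u (2 + h, y1, y2, y3) - 0) by ring.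
    assert (E : Rabs (2 + h - 2) < d).
    { replace (2 + h - 2) with h by ring. rewrite Rabs_pos_eq; lra. }
    assert (Z : forall z : R, Rabs (z - z) < d).
    { intros z. replace (z - z) with 0 by ring. rewrite Rabs_R0. exact Hd. }
    apply H; auto. lra. }
  apply (Rabs_le_all_eps l 6); [lra |]. intros e He.
  destruct (within_time_R4 (partial i u) (fun z => 2 < z) 2 x1 x2 x3 _ Hl e He) as [d [Hd Hdi]].
  assert (Z : forall z : R, Rabs (z - z) < d).
  { intros z. replace (z - z) with 0 by ring. rewrite Rabs_R0. exact Hd. }
  assert (Hs : 0 < d / 2) by lra. assert (Hes : 0 < e * (d / 2)) by (apply Rmult_lt_0_compat; lra).
  assert (E : forall h, 0 < h < d -> Rabs (2 + h - 2) < d).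
  { intros h Hh. replace (2 + h - 2) with h by ring. rewrite Rabs_pos_eq; lra. }
  assert (E' : forall y s, Rmin y (y + d / 2) <= s <= Rmax y (y + d / 2) -> Rabs (s - y) < d).
  { intros y s. rewrite Rmin_left, Rmax_right by lra. intros Hys. rewrite Rabs_pos_eq; lra. }
  destruct (small x1 x2 x3 _ Hes) as [d1 [Hd1 S1]].
  (* As h -> 0 the increment of u(2 + h, .) over a segment of fixed length d/2 tends to 0,
     while it stays within e d/2 of l d/2. *)
  assert (spatial : forall (y1 y2 y3 : R) (c : R -> R -> R * R * R * R) (y : R),
     (forall h, c (2 + h) y = (2 + h, x1, x2, x3)) ->
     (forall h, c (2 + h) (y + d / 2) = (2 + h, y1, y2, y3)) ->
     (forall h s, 0 < h < d -> Rmin y (y + d / 2) <= s <= Rmax y (y + d / 2) ->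
        is_derive (fun z => u (c (2 + h) z)) s (partial i u (c (2 + h) s)) /\
        Rabs (partial i u (c (2 + h) s) - l) < e) -> Rabs l <= 6 * e).
  { intros y1 y2 y3 c y c1 c2 H.
    destruct (small y1 y2 y3 _ Hes) as [d2 [Hd2 S2]].
    set (h := Rmin d (Rmin d1 d2) / 2).
    assert (Hh : 0 < h < d /\ h < d1 /\ h < d2).
    { assert (0 < Rmin d (Rmin d1 d2)) by (repeat apply Rmin_glb_lt; assumption).
      generalize (Rmin_l d (Rmin d1 d2)), (Rmin_r d (Rmin d1 d2)), (Rmin_l d1 d2), (Rmin_r d1 d2).
      unfold h. lra. }
    assert (I := increment_bound (fun z => u (c (2 + h) z)) (fun z => partial i u (c (2 + h) z))
      y (y + d / 2) l e).
    simpl in I. rewrite c1, c2 in I.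
    apply Rle_trans with (3 * e); [| lra].
    apply (slope_small l (d / 2) (u (2 + h, x1, x2, x3)) (u (2 + h, y1, y2, y3)) e Hs).
    - replace (y + d / 2 - y) with (d / 2) in I by ring.
      rewrite (Rabs_pos_eq (d / 2)) in I by lra. apply I.
      + intros s Hsy. apply H; tauto.
      + intros s Hsy. left. apply H; tauto.
    - apply S1. lra.
    - apply S2. lra. }
  assert (T2 : forall h y1 y2 y3, 0 < h -> 2 < time (2 + h, y1, y2, y3)) by (intros; simpl; lra).
  destruct i.
  - assert (Hd0 := Hdt x1 x2 x3 _ (locally_ball 0 (mkposreal e He))).
    destruct Hd0 as [d0 Hd0].
    set (h := Rmin d d0 / 2).
    assert (Hh : 0 < h /\ h < d /\ h < d0).
    { assert (0 < Rmin d d0) by (apply Rmin_glb_lt; [exact Hd | apply cond_pos]).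
      generalize (Rmin_l d d0), (Rmin_r d d0). unfold h. lra. }
    assert (Heh : 0 < e * h) by (apply Rmult_lt_0_compat; lra).
    destruct (small x1 x2 x3 (e * (h / 2)) ltac:(lra)) as [d2 [Hd2 S2]].
    (* The segment in time stops at 2 + h', short of 2, because u is differentiable only for t > 2.
       Continuity makes u(2 + h') negligible against e h, and h' <= h/2 keeps the length comparable
       to h. *)
    set (h' := Rmin h d2 / 2).
    assert (Hh' : 0 < h' /\ h' <= h / 2 /\ h' < d2).
    { assert (0 < Rmin h d2) by (apply Rmin_glb_lt; lra).
      generalize (Rmin_l h d2), (Rmin_r h d2). unfold h'. lra. }
    assert (Hb : Rabs (u (2 + h, x1, x2, x3)) <= e * h).
    { assert (Hball : ball 0 d0 h).
      { change (Rabs (h - 0) < d0). rewrite Rminus_0_r, Rabs_pos_eq; lra. }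
      assert (H := Hd0 h Hball (proj1 Hh)).
      change (Rabs ((u (2 + h, x1, x2, x3) - u (2, x1, x2, x3)) / h - 0) < e) in H.
      rewrite Hu0, !Rminus_0_r in H. unfold Rdiv in H.
      rewrite Rabs_mult, (Rabs_pos_eq (/ h)) in H by (left; apply Rinv_0_lt_compat; lra).
      left. apply Rmult_lt_reg_r with (/ h); [apply Rinv_0_lt_compat; lra |].
      replace (e * h * / h) with e by (field; lra). exact H. }
    assert (Ha := S2 h' ltac:(lra)).
    assert (I := increment_bound (fun z => u (z, x1, x2, x3)) (fun z => partial At u (z, x1, x2, x3))
      (2 + h') (2 + h) l e).
    replace (2 + h - (2 + h')) with (h - h') in I by ring.
    rewrite (Rabs_pos_eq (h - h')) in I by lra.
    assert (Rng : forall s, Rmin (2 + h') (2 + h) <= s <= Rmax (2 + h') (2 + h) ->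
       2 < s /\ Rabs (s - 2) < d).
    { intros s. rewrite Rmin_left, Rmax_right by lra. intros Hs'. split; [lra |].
      rewrite Rabs_pos_eq; lra. }
    assert (I' := I
      ltac:(intros s Hs'; apply (Derive_correct (fun z => u (z, x1, x2, x3)));
            apply (proj1 (Hu1 (s, x1, x2, x3) (proj1 (Rng s Hs')) At)))
      ltac:(intros s Hs'; left; apply Hdi; auto; apply (Rng s Hs'))).
    replace (6 * e) with (3 * (2 * e)) by ring.
    apply (slope_small l (h - h') (u (2 + h', x1, x2, x3)) (u (2 + h, x1, x2, x3)) (2 * e)).
    + lra.
    + eapply Rle_trans; [exact I' |]. apply Rmult_le_compat_r; lra.
    + eapply Rle_trans; [exact Ha |].
      replace (e * (h / 2)) with (e * h / 2) by field.
      apply Rle_trans with (2 * e * (h / 2)); [lra |]. apply Rmult_le_compat_l; lra.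
    + eapply Rle_trans; [exact Hb |]. replace (e * h) with (2 * e * (h / 2)) by field.
      apply Rmult_le_compat_l; lra.
  - apply (spatial (x1 + d / 2) x2 x3 (fun a z => (a, z, x2, x3)) x1); try reflexivity.
    intros h s Hh Hsy. split.
    + apply (Derive_correct (fun z => u (2 + h, z, x2, x3))).
      apply (proj1 (Hu1 (2 + h, s, x2, x3) (T2 h _ _ _ (proj1 Hh)) A1)).
    + apply Hdi; auto. lra.
  - apply (spatial x1 (x2 + d / 2) x3 (fun a z => (a, x1, z, x3)) x2); try reflexivity.
    intros h s Hh Hsy. split.
    + apply (Derive_correct (fun z => u (2 + h, x1, z, x3))).
      apply (proj1 (Hu1 (2 + h, x1, s, x3) (T2 h _ _ _ (proj1 Hh)) A2)).
    + apply Hdi; auto. lra.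
  - apply (spatial x1 x2 (x3 + d / 2) (fun a z => (a, x1, x2, z)) x3); try reflexivity.
    intros h s Hh Hsy. split.
    + apply (Derive_correct (fun z => u (2 + h, x1, x2, z))).
      apply (proj1 (Hu1 (2 + h, x1, x2, s) (T2 h _ _ _ (proj1 Hh)) A3)).
    + apply Hdi; auto. lra.
Qed.

(** [MVT_gen] asks for two-sided continuity at the end r = time p - 2 of the interval, beyond which
    u is arbitrary. With vanishing data, the extensions by zero of u and of its first derivatives
    are continuous everywhere. *)
Definition after2 (g : R * R * R * R -> R) (q : R * R * R * R) : R :=
  if Rlt_dec 2 (time q) then g q else 0.

Lemma after2_continuous (g : R * R * R * R -> R) (q : R * R * R * R) :
  (2 < time q -> continuous g q) ->
  (time q = 2 -> filterlim g (within (fun q => 2 < time q) (locally q)) (locally 0)) ->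
  continuous (after2 g) q.
Proof.
  intros H1 H2. destruct (Rtotal_order 2 (time q)) as [H | [H | H]].
  - apply continuous_ext_loc with g; [| auto].
    generalize (open_time_gt 2 q H). apply filter_imp. intros y Hy.
    unfold after2. destruct (Rlt_dec 2 (time y)); [reflexivity | contradiction].
  - symmetry in H. specialize (H2 H).
    intros P HP. unfold after2 at 1 in HP. destruct (Rlt_dec 2 (time q)) as [Hq | _]; [lra |].
    specialize (H2 P HP). unfold filtermap, within in *. revert H2. apply filter_imp.
    intros y Hy. unfold after2. destruct (Rlt_dec 2 (time y)); [auto |].
    exact (locally_singleton 0 P HP).
  - apply continuous_ext_loc with (fun _ => 0); [| apply continuous_const].
    destruct q as [[[t x1] x2] x3]. simpl in H. apply locally_R4.
    assert (Hd : 0 < 2 - t) by lra. exists (mkposreal _ Hd). simpl.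
    intros t' y1 y2 y3 H0 _ _ _. apply Rabs_def2 in H0. unfold after2. simpl.
    destruct (Rlt_dec 2 t'); [lra | reflexivity].
Qed.

(** F is the cone integral of W minus s times that of u. F(0) is 4 pi (W - s u)(p), F(time p - 2) is
    nonnegative by the data, and F does not increase. [T < 2] makes t = 2 interior for W; the
    condition on Box W alone includes t = 2, where u may have no second derivatives. The signs s = 1
    and s = -1 give the bound on |u|. *)
Lemma comparison (T : R) (u W : R * R * R * R -> R) (p : R * R * R * R) (s : R) :
  T < 2 ->
  C2_on (fun q => T < time q) W ->
  classical_regularity u ->
  (forall x1 x2 x3, u (2, x1, x2, x3) = 0) ->
  (forall x1 x2 x3, is_initial_dt u x1 x2 x3 0) ->
  (forall q, 2 <= time q -> Box W q <= 0) ->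
  (forall q, 2 < time q -> Box W q <= s * Box u q) ->
  (forall q, time q = 2 -> 0 <= W q) ->
  (forall q a b c, time q = 2 -> a * a + b * b + c * c = 1 ->
     0 <= partial At W q + a * partial A1 W q + b * partial A2 W q + c * partial A3 W q) ->
  2 < time p ->
  s * u p <= W p.
Proof.
  intros HT HW Hu Hu0 Hdt HBW HB HW0 HW1 Hp.
  assert (Hgrad := fun i q => initial_gradient_zero u i q Hu Hu0 Hdt).
  destruct Hu as [Hu2 [Huc _]].
  set (G := fun i => after2 (partial i u)).
  set (GW := fun i => partial i W).
  set (Gu := fun i => partial i u).
  assert (C2u : forall i q, continuous (G i) q).
  { intros i q. apply after2_continuous.
    - intros Hq. apply (proj1 Hu2 q Hq i).
    - apply Hgrad. }
  assert (C1u : forall q, continuous (after2 u) q).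
  { intros q. apply after2_continuous.
    - intros Hq. apply (C1_on_continuous _ u q (open_time_gt 2) (proj1 Hu2) Hq).
    - intros Hq. assert (Hq' : 2 <= time q) by lra. specialize (Huc q Hq').
      destruct q as [[[t x1] x2] x3]. simpl in Hq. subst t. rewrite Hu0 in Huc.
      revert Huc. apply filterlim_filter_le_1. intros P HP. unfold within in *.
      revert HP. apply filter_imp. intros y Hy Hy2. apply Hy. lra. }
  set (F := fun r => cone_integral W GW p r - s * cone_integral (after2 u) G p r).
  set (dF := fun r => r * sphere_integral (fun phi th => sin th * Box W (cone_point p r phi th))
     - s * (r * sphere_integral (fun phi th => sin th * after2 (Box u) (cone_point p r phi th)))).
  assert (Htp : 0 < time p - 2) by lra.
  destruct (MVT_gen F 0 (time p - 2) dF) as [c [Hc E]].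
  - rewrite Rmin_left, Rmax_right by lra. intros r Hr.
    assert (D1 := cone_integral_derive T W p r HW ltac:(lra)).
    assert (D2 := cone_integral_derive 2 u p r Hu2 ltac:(lra)).
    assert (D2' : is_derive (cone_integral (after2 u) G p) r
      (r * sphere_integral (fun phi th => sin th * after2 (Box u) (cone_point p r phi th)))).
    { replace (sphere_integral (fun phi th => sin th * after2 (Box u) (cone_point p r phi th)))
        with (sphere_integral (fun phi th => sin th * Box u (cone_point p r phi th))).
      - revert D2. apply is_derive_ext_loc.
        assert (Hd : 0 < time p - 2 - r) by lra. exists (mkposreal _ Hd). intros y Hy.
        change (Rabs (y - r) < time p - 2 - r) in Hy. apply Rabs_def2 in Hy.
        apply sphere_integral_ext. intros phi th. unfold cone_density, G, after2.
        rewrite time_cone_point. destruct (Rlt_dec 2 (time p - y)); [reflexivity | lra].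
      - apply sphere_integral_ext. intros phi th. unfold after2.
        rewrite time_cone_point. destruct (Rlt_dec 2 (time p - r)); [reflexivity | lra]. }
    unfold F, dF.
    apply (is_derive_minus (V := R_NormedModule) _ _ _ _ _ D1).
    apply (is_derive_scal _ r s _ D2').
  - rewrite Rmin_left, Rmax_right by lra. intros r Hr.
    apply continuity_pt_filterlim.
    apply (continuous_Rminus (cone_integral W GW p)
      (fun r => s * cone_integral (after2 u) G p r)).
    + apply (is_derive_continuous_R _ _ _ (cone_integral_derive T W p r HW ltac:(lra))).
    + apply continuous_Rmult; [apply continuous_const |].
      apply cone_integral_continuous. apply filter_forall. auto.
  - rewrite Rmin_left, Rmax_right in Hc by lra.
    assert (E0 : F 0 = 4 * PI * (W p - s * u p)).
    { unfold F. rewrite !cone_integral_0. unfold after2.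
      destruct (Rlt_dec 2 (time p)); [ring | lra]. }
    assert (E1 : 0 <= F (time p - 2)).
    { unfold F. set (r := time p - 2) in *.
      (* This cone section lies in t = 2, where the extension by zero vanishes, so only the data of
         W remain. *)
      replace (cone_integral (after2 u) G p r) with 0.
      - rewrite Rmult_0_r, Rminus_0_r. apply sphere_integral_nonneg.
        + apply continuous3_2, cone_density_continuous.
          * intros q Hq. apply (C1_on_continuous _ W q (open_time_gt T) (proj1 HW)).
            unfold r in Hq. lra.
          * intros i q Hq. apply (proj1 HW q). unfold r in Hq. lra.
        + intros phi th Hth. unfold cone_density.
          assert (Hq : time (cone_point p r phi th) = 2).
          { rewrite time_cone_point. unfold r. ring. }
          apply Rmult_le_pos; [apply sin_ge_0; lra |].
          apply Rplus_le_le_0_compat; [apply HW0, Hq |].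
          apply Rmult_le_pos; [lra |]. apply HW1; [exact Hq |].
          generalize (sin2_cos2 phi), (sin2_cos2 th). unfold Rsqr. intros e1 e2.
          replace (sin th * cos phi * (sin th * cos phi) + sin th * sin phi * (sin th * sin phi)
            + cos th * cos th) with (sin th * sin th * (sin phi * sin phi + cos phi * cos phi)
            + cos th * cos th) by ring.
          rewrite e1. lra.
      - symmetry.
        transitivity (sphere_integral (fun _ th => sin th * 0)).
        + apply sphere_integral_ext. intros phi th. unfold cone_density, G, after2.
          rewrite time_cone_point. unfold r.
          destruct (Rlt_dec 2 (time p - (time p - 2))); [lra | ring].
        + rewrite sphere_integral_sin. ring. }
    assert (E2 : dF c <= 0).
    { set (f1 := fun phi th => sin th * Box W (cone_point p c phi th)).
      set (f2 := fun phi th => sin th * after2 (Box u) (cone_point p c phi th)).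
      assert (K1 : continuous2 f1) by (apply (Box_density_continuous T); [exact HW | lra]).
      assert (K2 : continuous2 f2).
      { unfold f2. destruct (Rlt_dec 2 (time p - c)) as [Hlt | Hlt].
        - intros phi th. apply continuous_ext with
            (fun q : R * R => sin (snd q) * Box u (cone_point p c (fst q) (snd q))).
          + intros q. unfold after2. rewrite time_cone_point.
            destruct (Rlt_dec 2 (time p - c)); [reflexivity | contradiction].
          + apply (Box_density_continuous 2 u p c Hu2 Hlt).
        - intros phi th. apply continuous_ext with (fun q : R * R => 0).
          + intros q. unfold after2. rewrite time_cone_point.
            destruct (Rlt_dec 2 (time p - c)); [contradiction | symmetry; apply Rmult_0_r].
          + apply continuous_const. }
      assert (K3 : continuous2 (fun phi th => s * f2 phi th)).
      { intros phi th. apply continuous_Rmult; [apply continuous_const | apply K2]. }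
      assert (K : 0 <= sphere_integral (fun phi th => s * f2 phi th + (-1) * f1 phi th)).
      { apply sphere_integral_nonneg.
        - intros phi th. apply continuous_Rplus; [apply K3 |].
          apply continuous_Rmult; [apply continuous_const | apply K1].
        - intros phi th Hth. unfold f1, f2.
          replace (s * (sin th * after2 (Box u) (cone_point p c phi th)) +
             -1 * (sin th * Box W (cone_point p c phi th))) with
            (sin th * (s * after2 (Box u) (cone_point p c phi th) - Box W (cone_point p c phi th)))
            by ring.
          apply Rmult_le_pos; [apply sin_ge_0; lra |].
          unfold after2. destruct (Rlt_dec 2 (time (cone_point p c phi th))) as [Hq | Hq].
          + generalize (HB _ Hq). lra.
          (* The mean value point may be the endpoint c = time p - 2. The extended source is zero
             there, and the sign of Box W on the slice itself is used. *)
          + assert (Hq2 : 2 <= time (cone_point p c phi th)) by (rewrite time_cone_point; lra).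
            generalize (HBW _ Hq2). lra. }
      rewrite sphere_integral_plus, !sphere_integral_scal in K; try assumption.
      - unfold dF. fold f1 f2.
        replace (c * sphere_integral f1 - s * (c * sphere_integral f2)) with
          (- (c * (s * sphere_integral f2 + -1 * sphere_integral f1))) by ring.
        assert (0 <= c * (s * sphere_integral f2 + -1 * sphere_integral f1))
          by (apply Rmult_le_pos; lra). lra.
      - intros phi th. apply continuous_Rmult; [apply continuous_const | apply K1]. }
    assert (E3 : dF c * (time p - 2 - 0) <= 0).
    { replace 0 with (0 * (time p - 2 - 0)) at 2 by ring. apply Rmult_le_compat_r; lra. }
    assert (E4 : 0 <= 4 * PI * (W p - s * u p)) by (rewrite <- E0; lra).
    assert (HPI := PI_RGT_0).
    apply Rmult_le_reg_l with (4 * PI); [lra |]. lra.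
Qed.

(** * Radial functions and the cut-off *)


Definition cont2 (g : R -> R -> R) (t m : R) : Prop :=
  continuous (fun q : R * R => g (fst q) (snd q)) (t, m).

Definition diff2 (g gt gm : R -> R -> R) (t m : R) : Prop :=
  is_derive (fun z => g z m) t (gt t m) /\ is_derive (fun z => g t z) m (gm t m).

(** The derivatives are explicit functions, so that Box becomes algebra; a single [gtm] serves both
    mixed orders. Differentiability is two-sided in m, hence asked slightly below m = 0 as well. *)
Record C2_at (g gt gm gtt gtm gmm : R -> R -> R) (t m : R) : Prop := {
  C2_g : diff2 g gt gm t m;
  C2_gt : diff2 gt gtt gtm t m;
  C2_gm : diff2 gm gtm gmm t m;
  C2_cont : cont2 g t m /\ cont2 gt t m /\ cont2 gm t m /\
            cont2 gtt t m /\ cont2 gtm t m /\ cont2 gmm t m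
}.

Lemma C1_on_intro (D : R * R * R * R -> Prop) (g : R * R * R * R -> R)
    (dg : axis -> R * R * R * R -> R) :
  open D ->
  (forall p i, D p -> is_derive (fun s => g (set_coord i p s)) (coord i p) (dg i p)) ->
  (forall p i, D p -> continuous (dg i) p) ->
  C1_on D g /\ forall p i, D p -> partial i g p = dg i p.
Proof.
  intros HD Hd Hc.
  assert (E : forall p i, D p -> partial i g p = dg i p).
  { intros p i Hp. apply is_derive_unique, Hd, Hp. }
  split; [| exact E].
  intros p Hp i. split.
  - exists (dg i p). apply Hd, Hp.
  - apply continuous_ext_loc with (dg i); [| apply Hc, Hp].
    generalize (HD p Hp). apply filter_imp. intros q Hq. symmetry. apply E, Hq.
Qed.

Lemma set_coord_id (i : axis) (p : R * R * R * R) : set_coord i p (coord i p) = p.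
Proof. destruct p as [[[t x1] x2] x3], i; reflexivity. Qed.

Lemma locally_set_coord (P : R * R * R * R -> Prop) (i : axis) (p : R * R * R * R) :
  locally p P -> locally (coord i p) (fun s => P (set_coord i p s)).
Proof.
  intros H. assert (C : continuous (set_coord i p) (coord i p)).
  { destruct p as [[[t x1] x2] x3], i; unfold set_coord; cont. }
  apply C. rewrite set_coord_id. exact H.
Qed.

Lemma partial_ext_on (D : R * R * R * R -> Prop) (f g : R * R * R * R -> R)
    (i : axis) (p : R * R * R * R) :
  open D -> (forall q, D q -> f q = g q) -> D p -> partial i f p = partial i g p.
Proof.
  intros HD H Hp. apply Derive_ext_loc.
  generalize (locally_set_coord D i p (HD p Hp)). apply filter_imp. intros s Hs. apply H, Hs.
Qed.

Lemma C1_on_ext (D : R * R * R * R -> Prop) (f g : R * R * R * R -> R) :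
  open D -> (forall q, D q -> f q = g q) -> C1_on D f -> C1_on D g.
Proof.
  intros HD H Hf p Hp i. destruct (Hf p Hp i) as [H1 H2]. split.
  - unfold ex_partial in *. revert H1. apply ex_derive_ext_loc.
    generalize (locally_set_coord D i p (HD p Hp)). apply filter_imp. intros s Hs. apply H, Hs.
  - revert H2. apply continuous_ext_loc. generalize (HD p Hp). apply filter_imp.
    intros q Hq. apply (partial_ext_on D); assumption.
Qed.

Lemma is_derive_plus_R (f g : R -> R) (x df dg : R) :
  is_derive f x df -> is_derive g x dg -> is_derive (fun z => f z + g z) x (df + dg).
Proof. apply (is_derive_plus (V := R_NormedModule)). Qed.

Lemma is_derive_mult_R (f g : R -> R) (x df dg : R) :
  is_derive f x df -> is_derive g x dg ->
  is_derive (fun z => f z * g z) x (df * g x + f x * dg).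
Proof. intros Hf Hg. exact (is_derive_mult f g x df dg Hf Hg Rmult_comm). Qed.

Definition sqnorm (p : R * R * R * R) : R :=
  let '(_, x1, x2, x3) := p in x1 ^ 2 + x2 ^ 2 + x3 ^ 2.

(** The second variable is r^2 rather than r, which is smooth at the spatial origin. *)
Definition rad (g : R -> R -> R) (p : R * R * R * R) : R := g (time p) (sqnorm p).

Lemma sqnorm_nonneg (p : R * R * R * R) : 0 <= sqnorm p.
Proof. destruct p as [[[t x1] x2] x3]. simpl. nra. Qed.

Lemma rad_continuous (g : R -> R -> R) (p : R * R * R * R) :
  cont2 g (time p) (sqnorm p) -> continuous (rad g) p.
Proof.
  intros H. apply (continuous_comp (fun q => (time q, sqnorm q))
    (fun q : R * R => g (fst q) (snd q))); [| exact H].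
  apply (continuous_ext (fun q : R * R * R * R => (fst (fst (fst q)),
    snd (fst (fst q)) * snd (fst (fst q)) + snd (fst q) * snd (fst q) + snd q * snd q))).
  { intros [[[t x1] x2] x3]. simpl. f_equal. ring. }
  assert (F2 : continuous (fun q : R * R * R * R => fst (fst q)) p).
  { apply (continuous_comp fst fst); apply continuous_fst. }
  assert (F3 : continuous (fun q : R * R * R * R => fst (fst (fst q))) p).
  { apply (continuous_comp (fun q : R * R * R * R => fst (fst q)) fst);
      [exact F2 | apply continuous_fst]. }
  assert (F4 : continuous (fun q : R * R * R * R => snd (fst (fst q))) p).
  { apply (continuous_comp (fun q : R * R * R * R => fst (fst q)) snd);
      [exact F2 | apply continuous_snd]. }
  cont; assumption.
Qed.

Lemma coord_continuous (i : axis) (p : R * R * R * R) : continuous (coord i) p.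
Proof.
  destruct p as [[[t x1] x2] x3]. intros P [e He]. apply locally_R4. exists e.
  intros t' y1 y2 y3 H0 H1 H2 H3. apply He. destruct i; assumption.
Qed.

Definition rad_grad (gt gm : R -> R -> R) (i : axis) (p : R * R * R * R) : R :=
  match i with At => rad gt p | _ => 2 * coord i p * rad gm p end.

Lemma rad_derive (g gt gm : R -> R -> R) (i : axis) (p : R * R * R * R) :
  diff2 g gt gm (time p) (sqnorm p) ->
  is_derive (fun s => rad g (set_coord i p s)) (coord i p) (rad_grad gt gm i p).
Proof.
  intros [H1 H2]. destruct p as [[[t x1] x2] x3]. destruct i; unfold rad, rad_grad; simpl.
  - exact H1.
  - apply (is_derive_comp (fun m => g t m) (fun s => s ^ 2 + x2 ^ 2 + x3 ^ 2)).
    + exact H2.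
    + auto_derive; [exact I | ring].
  - apply (is_derive_comp (fun m => g t m) (fun s => x1 ^ 2 + s ^ 2 + x3 ^ 2)).
    + exact H2.
    + auto_derive; [exact I | ring].
  - apply (is_derive_comp (fun m => g t m) (fun s => x1 ^ 2 + x2 ^ 2 + s ^ 2)).
    + exact H2.
    + auto_derive; [exact I | ring].
Qed.

Lemma rad_grad_continuous (gt gm : R -> R -> R) (i : axis) (p : R * R * R * R) :
  cont2 gt (time p) (sqnorm p) -> cont2 gm (time p) (sqnorm p) ->
  continuous (rad_grad gt gm i) p.
Proof.
  intros H1 H2. apply rad_continuous in H1. apply rad_continuous in H2.
  destruct i; unfold rad_grad; [exact H1 | | |]; cont;
    lazymatch goal with
    | |- continuous (fun _ => rad _ _) _ => exact H2
    | |- _ => apply coord_continuous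
    end.
Qed.

(** In dimension n the Laplacian of g(|x|^2) is 4 m g_mm + 2 n g_m, whence the 6. Each first partial
    is identified on the open set D with [rad gt] or 2 x_j [rad gm] before it is differentiated
    again. *)
Lemma rad_C2 (T : R) (g gt gm gtt gtm gmm : R -> R -> R) :
  (forall t m, T < t -> 0 <= m -> C2_at g gt gm gtt gtm gmm t m) ->
  C2_on (fun q => T < time q) (rad g) /\
  (forall p i, T < time p -> partial i (rad g) p = rad_grad gt gm i p) /\
  (forall p, T < time p -> Box (rad g) p =
     - gtt (time p) (sqnorm p) + 4 * sqnorm p * gmm (time p) (sqnorm p)
     + 6 * gm (time p) (sqnorm p)).
Proof.
  intros H. set (D := fun q : R * R * R * R => T < time q).
  assert (HD : open D) by apply open_time_gt.
  assert (H' : forall p, D p -> C2_at g gt gm gtt gtm gmm (time p) (sqnorm p)).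
  { intros p Hp. apply H; [exact Hp | apply sqnorm_nonneg]. }
  assert (cm : forall p, D p -> cont2 gm (time p) (sqnorm p)).
  { intros p Hp. destruct (H' p Hp) as [_ _ _ Hc]. tauto. }
  assert (ct : forall p, D p -> cont2 gt (time p) (sqnorm p)).
  { intros p Hp. destruct (H' p Hp) as [_ _ _ Hc]. tauto. }
  assert (ctt : forall p, D p -> cont2 gtt (time p) (sqnorm p)).
  { intros p Hp. destruct (H' p Hp) as [_ _ _ Hc]. tauto. }
  assert (ctm : forall p, D p -> cont2 gtm (time p) (sqnorm p)).
  { intros p Hp. destruct (H' p Hp) as [_ _ _ Hc]. tauto. }
  assert (cmm : forall p, D p -> cont2 gmm (time p) (sqnorm p)).
  { intros p Hp. destruct (H' p Hp) as [_ _ _ Hc]. tauto. }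
  assert (R0 : C1_on D (rad g) /\ forall p i, D p -> partial i (rad g) p = rad_grad gt gm i p).
  { apply C1_on_intro; [exact HD | |].
    - intros p i Hp. apply rad_derive, (C2_g _ _ _ _ _ _ _ _ (H' p Hp)).
    - intros p i Hp. exact (rad_grad_continuous gt gm i p (ct p Hp) (cm p Hp)). }
  assert (R1 : C1_on D (rad gt) /\ forall p i, D p -> partial i (rad gt) p = rad_grad gtt gtm i p).
  { apply C1_on_intro; [exact HD | |].
    - intros p i Hp. apply rad_derive, (C2_gt _ _ _ _ _ _ _ _ (H' p Hp)).
    - intros p i Hp. exact (rad_grad_continuous gtt gtm i p (ctt p Hp) (ctm p Hp)). }
  set (kron := fun i j : axis => match i, j with
     | At, At | A1, A1 | A2, A2 | A3, A3 => 1 | _, _ => 0 end).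
  assert (R2 : forall j, C1_on D (fun p => 2 * coord j p * rad gm p) /\ forall p i, D p ->
     partial i (fun p => 2 * coord j p * rad gm p) p
     = 2 * kron i j * rad gm p + 2 * coord j p * rad_grad gtm gmm i p).
  { intros j. apply (C1_on_intro D (fun p => 2 * coord j p * rad gm p)
      (fun i p => 2 * kron i j * rad gm p + 2 * coord j p * rad_grad gtm gmm i p)); [exact HD | |].
    - intros p i Hp.
      assert (d1 : is_derive (fun s => 2 * coord j (set_coord i p s)) (coord i p) (2 * kron i j)).
      { destruct p as [[[t x1] x2] x3]; destruct i, j; simpl; auto_derive; trivial; ring. }
      assert (d2 := rad_derive gm gtm gmm i p (C2_gm _ _ _ _ _ _ _ _ (H' p Hp))).
      assert (d3 := is_derive_mult_R _ _ _ _ _ d1 d2). simpl in d3.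
      rewrite set_coord_id in d3. exact d3.
    - intros p i Hp. assert (Ci := coord_continuous j p).
      assert (C1 := rad_continuous gm p (cm p Hp)).
      assert (C2 := rad_grad_continuous gtm gmm i p (ctm p Hp) (cmm p Hp)).
      cont; assumption. }
  assert (Q : forall j, j <> At -> forall q, D q ->
     2 * coord j q * rad gm q = partial j (rad g) q).
  { intros j Hj q Hq. rewrite (proj2 R0 q j Hq). destruct j; try reflexivity. congruence. }
  assert (Q0 : forall q, D q -> rad gt q = partial At (rad g) q).
  { intros q Hq. rewrite (proj2 R0 q At Hq). reflexivity. }
  split; [| split].
  - split; [apply R0 |]. intros j.
    destruct j.
    + apply (C1_on_ext D _ _ HD Q0), R1.
    + apply (C1_on_ext D _ _ HD (Q A1 ltac:(discriminate))), R2.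
    + apply (C1_on_ext D _ _ HD (Q A2 ltac:(discriminate))), R2.
    + apply (C1_on_ext D _ _ HD (Q A3 ltac:(discriminate))), R2.
  - apply R0.
  - intros p Hp. unfold Box.
    rewrite <- (partial_ext_on D _ _ At p HD Q0 Hp),
      <- (partial_ext_on D _ _ A1 p HD (Q A1 ltac:(discriminate)) Hp),
      <- (partial_ext_on D _ _ A2 p HD (Q A2 ltac:(discriminate)) Hp),
      <- (partial_ext_on D _ _ A3 p HD (Q A3 ltac:(discriminate)) Hp).
    rewrite (proj2 R1 p At Hp), (proj2 (R2 A1) p A1 Hp), (proj2 (R2 A2) p A2 Hp),
      (proj2 (R2 A3) p A3 Hp).
    destruct p as [[[t x1] x2] x3]. unfold rad_grad, rad, kron; simpl. ring.
Qed.

Lemma diff2_plus (f ft fm g gt gm : R -> R -> R) (t m : R) :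
  diff2 f ft fm t m -> diff2 g gt gm t m ->
  diff2 (fun t m => f t m + g t m) (fun t m => ft t m + gt t m) (fun t m => fm t m + gm t m) t m.
Proof.
  intros [H1 H2] [H3 H4]. split.
  - apply (is_derive_plus_R (fun z => f z m) (fun z => g z m)); assumption.
  - apply (is_derive_plus_R (fun z => f t z) (fun z => g t z)); assumption.
Qed.

Lemma diff2_mult (f ft fm g gt gm : R -> R -> R) (t m : R) :
  diff2 f ft fm t m -> diff2 g gt gm t m ->
  diff2 (fun t m => f t m * g t m) (fun t m => ft t m * g t m + f t m * gt t m)
    (fun t m => fm t m * g t m + f t m * gm t m) t m.
Proof.
  intros [H1 H2] [H3 H4]. split.
  - apply (is_derive_mult_R (fun z => f z m) (fun z => g z m)); assumption.
  - apply (is_derive_mult_R (fun z => f t z) (fun z => g t z)); assumption.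
Qed.

Lemma diff2_eq (f ft fm ft' fm' : R -> R -> R) (t m : R) :
  ft t m = ft' t m -> fm t m = fm' t m -> diff2 f ft fm t m -> diff2 f ft' fm' t m.
Proof. intros E1 E2 [H1 H2]. rewrite E1 in H1. rewrite E2 in H2. split; assumption. Qed.

Lemma C2_at_plus (f ft fm ftt ftm fmm g gt gm gtt gtm gmm : R -> R -> R) (t m : R) :
  C2_at f ft fm ftt ftm fmm t m -> C2_at g gt gm gtt gtm gmm t m ->
  C2_at (fun t m => f t m + g t m) (fun t m => ft t m + gt t m) (fun t m => fm t m + gm t m)
    (fun t m => ftt t m + gtt t m) (fun t m => ftm t m + gtm t m)
    (fun t m => fmm t m + gmm t m) t m.
Proof.
  intros [a1 a2 a3 a4] [b1 b2 b3 b4]. split; try (apply diff2_plus; assumption).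
  unfold cont2 in *. repeat split; cont; tauto.
Qed.

Lemma C2_at_scal (c : R) (g gt gm gtt gtm gmm : R -> R -> R) (t m : R) :
  C2_at g gt gm gtt gtm gmm t m ->
  C2_at (fun t m => c * g t m) (fun t m => c * gt t m) (fun t m => c * gm t m)
    (fun t m => c * gtt t m) (fun t m => c * gtm t m) (fun t m => c * gmm t m) t m.
Proof.
  assert (K : forall h ht hm : R -> R -> R, diff2 h ht hm t m -> diff2 (fun t m => c * h t m)
    (fun t m => c * ht t m) (fun t m => c * hm t m) t m).
  { intros h ht hm [H1 H2]. split; apply is_derive_scal; assumption. }
  intros [b1 b2 b3 b4]. split; try (apply K; assumption).
  unfold cont2 in *. repeat split; cont; tauto.
Qed.

Lemma C2_at_mult (f ft fm ftt ftm fmm g gt gm gtt gtm gmm : R -> R -> R) (t m : R) :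
  C2_at f ft fm ftt ftm fmm t m -> C2_at g gt gm gtt gtm gmm t m ->
  C2_at (fun t m => f t m * g t m) (fun t m => ft t m * g t m + f t m * gt t m)
    (fun t m => fm t m * g t m + f t m * gm t m)
    (fun t m => ftt t m * g t m + 2 * (ft t m * gt t m) + f t m * gtt t m)
    (fun t m => ftm t m * g t m + ft t m * gm t m + fm t m * gt t m + f t m * gtm t m)
    (fun t m => fmm t m * g t m + 2 * (fm t m * gm t m) + f t m * gmm t m) t m.
Proof.
  intros [a1 a2 a3 (c1 & c2 & c3 & c4 & c5 & c6)] [b1 b2 b3 (d1 & d2 & d3 & d4 & d5 & d6)]. split.
  - apply diff2_mult; assumption.
  - eapply diff2_eq; [| | apply diff2_plus; apply diff2_mult; eassumption]; simpl; ring.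
  - eapply diff2_eq; [| | apply diff2_plus; apply diff2_mult; eassumption]; simpl; ring.
  - unfold cont2 in *. repeat split; cont; assumption.
Qed.

Lemma locally_prod (P : R -> R -> Prop) (t m : R) :
  locally (t, m) (fun q : R * R => P (fst q) (snd q)) <->
  exists d : posreal, forall t' m', Rabs (t' - t) < d -> Rabs (m' - m) < d -> P t' m'.
Proof.
  split; intros [d Hd]; exists d.
  - intros t' m' H1 H2. apply (Hd (t', m')). split; assumption.
  - intros [t' m'] [H1 H2]. apply Hd; assumption.
Qed.

(** Covers the places where the general formulas break down but the cut-off makes the function
    constant: near m = 0, where sqrt is not differentiable, and where t^2 - m <= 0. *)
Lemma C2_at_locally_const (c : R) (g gt gm gtt gtm gmm : R -> R -> R) (t m : R) :
  locally (t, m) (fun q : R * R => g (fst q) (snd q) = c /\ gt (fst q) (snd q) = 0 /\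
    gm (fst q) (snd q) = 0 /\ gtt (fst q) (snd q) = 0 /\ gtm (fst q) (snd q) = 0 /\
    gmm (fst q) (snd q) = 0) ->
  C2_at g gt gm gtt gtm gmm t m.
Proof.
  intros H.
  assert (C : forall c h, locally (t, m) (fun q : R * R => h (fst q) (snd q) = c) ->
    cont2 h t m).
  { intros c' h Hh. apply (continuous_ext_loc _ (fun _ => c')); [| apply continuous_const].
    revert Hh. apply filter_imp. intros q Hq. symmetry. exact Hq. }
  assert (K : forall c' h ht hm, locally (t, m) (fun q : R * R => h (fst q) (snd q) = c') ->
    ht t m = 0 -> hm t m = 0 -> diff2 h ht hm t m).
  { intros c' h ht hm Hh E1 E2.
    apply (locally_prod (fun t m => h t m = c')) in Hh. destruct Hh as [d Hd].
    assert (Z : forall z : R, Rabs (z - z) < d).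
    { intros z. replace (z - z) with 0 by ring. rewrite Rabs_R0. apply cond_pos. }
    split.
    - rewrite E1. apply (is_derive_ext_loc (fun _ => c')); [| apply @is_derive_const].
      exists d. intros y Hy. symmetry. apply Hd; [exact Hy | apply Z].
    - rewrite E2. apply (is_derive_ext_loc (fun _ => c')); [| apply @is_derive_const].
      exists d. intros y Hy. symmetry. apply Hd; [apply Z | exact Hy]. }
  assert (S := locally_singleton _ _ H). simpl in S.
  destruct S as (s1 & s2 & s3 & s4 & s5 & s6).
  assert (h1 := filter_imp _ _ (fun q h => proj1 h) H).
  assert (h2 := filter_imp _ _ (fun q h => proj1 (proj2 h)) H).
  assert (h3 := filter_imp _ _ (fun q h => proj1 (proj2 (proj2 h))) H).
  assert (h4 := filter_imp _ _ (fun q h => proj1 (proj2 (proj2 (proj2 h)))) H).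
  assert (h5 := filter_imp _ _ (fun q h => proj1 (proj2 (proj2 (proj2 (proj2 h))))) H).
  assert (h6 := filter_imp _ _ (fun q h => proj2 (proj2 (proj2 (proj2 (proj2 h))))) H).
  simpl in h1, h2, h3, h4, h5, h6.
  split.
  - apply (K c); assumption.
  - apply (K 0); assumption.
  - apply (K 0); assumption.
  - repeat split; eapply C; eassumption.
Qed.

(** * The profile of the cut-off *)

Definition clip (x : R) : R := Rmax 0 (Rmin 1 x).

Lemma clip_range (x : R) : 0 <= clip x <= 1.
Proof.
  unfold clip. split; [apply Rmax_l |]. apply Rmax_lub; [lra | apply Rmin_l].
Qed.

Lemma clip_le0 (x : R) : x <= 0 -> clip x = 0.
Proof. intros H. unfold clip. rewrite Rmin_right by lra. apply Rmax_left, H. Qed.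

Lemma clip_ge1 (x : R) : 1 <= x -> clip x = 1.
Proof. intros H. unfold clip. rewrite Rmin_left by lra. apply Rmax_right; lra. Qed.

Lemma clip_mid (x : R) : 0 <= x <= 1 -> clip x = x.
Proof. intros H. unfold clip. rewrite Rmin_right by lra. apply Rmax_right; lra. Qed.

Lemma clip_lipschitz (x y : R) : Rabs (clip y - clip x) <= Rabs (y - x).
Proof.
  unfold clip, Rmax, Rmin.
  destruct (Rle_dec 1 x), (Rle_dec 1 y); repeat destruct (Rle_dec 0 _);
  unfold Rabs; repeat destruct (Rcase_abs _); lra.
Qed.

Lemma clip_continuous (x : R) : continuous clip x.
Proof.
  intros P [e He]. exists e. intros y Hy. apply He.
  apply Rle_lt_trans with (1 := clip_lipschitz x y). exact Hy.
Qed.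

(** The kinks of [clip] at 0 and 1 are harmless because dg vanishes there: the estimate for a zero
    derivative passes from clip y to y, since [clip] is 1-Lipschitz. *)
Lemma clip_derive (g dg : R -> R) (x : R) :
  (forall y, is_derive g y (dg y)) -> dg 0 = 0 -> dg 1 = 0 ->
  is_derive (fun y => g (clip y)) x (dg (clip x)).
Proof.
  intros Hg H0 H1.
  assert (stat : clip x = x -> dg x = 0 -> is_derive (fun y => g (clip y)) x (dg (clip x))).
  { intros Ex Ed. rewrite Ex, Ed. destruct (Hg x) as [_ Hx]. rewrite Ed in Hx.
    split; [apply is_linear_scal_l |]. intros x' Hx' eps.
    assert (E : x = x') by (apply is_filter_lim_locally_unique; exact Hx'). subst x'.
    specialize (Hx x Hx' eps). destruct Hx as [d Hd]. exists d.
    intros y Hy. rewrite Ex.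
    assert (Hc : Rabs (clip y - x) <= Rabs (y - x)).
    { rewrite <- Ex at 1. apply clip_lipschitz. }
    assert (Hb : ball x d (clip y)).
    { apply Rle_lt_trans with (1 := Hc). exact Hy. }
    specialize (Hd (clip y) Hb).
    change (Rabs (g (clip y) - g x - (clip y - x) * 0) <= eps * Rabs (clip y - x)) in Hd.
    change (Rabs (g (clip y) - g x - (y - x) * 0) <= eps * Rabs (y - x)).
    rewrite Rmult_0_r in *. apply Rle_trans with (1 := Hd).
    apply Rmult_le_compat_l; [left; apply cond_pos | exact Hc]. }
  destruct (Rtotal_order x 0) as [H | [H | H]].
  - rewrite clip_le0, H0 by lra.
    apply (is_derive_ext_loc (fun _ => g 0)); [| apply @is_derive_const].
    assert (Hd : 0 < - x) by lra. exists (mkposreal _ Hd). intros y Hy.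
    change (Rabs (y - x) < - x) in Hy. apply Rabs_def2 in Hy. rewrite clip_le0; [reflexivity | lra].
  - apply stat; subst x; [apply clip_mid; lra | exact H0].
  - destruct (Rtotal_order x 1) as [K | [K | K]].
    + rewrite clip_mid by lra. apply (is_derive_ext_loc g); [| apply Hg].
      assert (Hd : 0 < Rmin x (1 - x)) by (apply Rmin_glb_lt; lra).
      exists (mkposreal _ Hd). intros y Hy.
      change (Rabs (y - x) < Rmin x (1 - x)) in Hy. apply Rabs_def2 in Hy.
      generalize (Rmin_l x (1 - x)), (Rmin_r x (1 - x)). intros.
      rewrite clip_mid; [reflexivity | lra].
    + apply stat; subst x; [apply clip_mid; lra | exact H1].
    + rewrite clip_ge1, H1 by lra.
      apply (is_derive_ext_loc (fun _ => g 1)); [| apply @is_derive_const].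
      assert (Hd : 0 < x - 1) by lra. exists (mkposreal _ Hd). intros y Hy.
      change (Rabs (y - x) < x - 1) in Hy. apply Rabs_def2 in Hy.
      rewrite clip_ge1; [reflexivity | lra].
Qed.

(* chi is the quintic smoothstep rising from 0 at 1/2 to 1 at 1; chi1, chi2 are its derivatives. *)
Definition chi (q : R) : R :=
  let x := clip (2 * q - 1) in x ^ 3 * (10 - 15 * x + 6 * x ^ 2).
Definition chi1 (q : R) : R :=
  let x := clip (2 * q - 1) in 60 * (x * (1 - x)) ^ 2.
Definition chi2 (q : R) : R :=
  let x := clip (2 * q - 1) in 240 * x * (1 - x) * (1 - 2 * x).

Lemma chi_derive (q : R) : is_derive chi q (chi1 q).
Proof.
  assert (H := clip_derive (fun x => x ^ 3 * (10 - 15 * x + 6 * x ^ 2))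
    (fun x => 30 * (x * (1 - x)) ^ 2) (2 * q - 1)).
  assert (H' : is_derive (fun q => 2 * q - 1) q 2) by (auto_derive; [exact I | ring]).
  replace (chi1 q) with (2 * (30 * (clip (2 * q - 1) * (1 - clip (2 * q - 1))) ^ 2))
    by (unfold chi1; ring).
  apply (is_derive_comp (fun y => clip y ^ 3 * (10 - 15 * clip y + 6 * clip y ^ 2))
     (fun q => 2 * q - 1) q _ _); [| exact H'].
  apply H; [| ring | ring]. intros y. auto_derive; [exact I | ring].
Qed.

Lemma chi1_derive (q : R) : is_derive chi1 q (chi2 q).
Proof.
  assert (H := clip_derive (fun x => 60 * (x * (1 - x)) ^ 2)
    (fun x => 120 * x * (1 - x) * (1 - 2 * x)) (2 * q - 1)).
  assert (H' : is_derive (fun q => 2 * q - 1) q 2) by (auto_derive; [exact I | ring]).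
  replace (chi2 q) with (2 * (120 * clip (2 * q - 1) * (1 - clip (2 * q - 1))
    * (1 - 2 * clip (2 * q - 1)))) by (unfold chi2; ring).
  apply (is_derive_comp (fun y => 60 * (clip y * (1 - clip y)) ^ 2)
     (fun q => 2 * q - 1) q _ _); [| exact H'].
  apply H; [| ring | ring]. intros y. auto_derive; [exact I | ring].
Qed.

Lemma chi2_continuous (q : R) : continuous chi2 q.
Proof.
  unfold chi2.
  assert (C : continuous (fun q => clip (2 * q - 1)) q).
  { apply (continuous_Rcomp (fun q => 2 * q - 1) clip); [apply clip_continuous | cont]. }
  cont; exact C.
Qed.

Lemma chi_low (q : R) : q <= 1 / 2 -> chi q = 0 /\ chi1 q = 0 /\ chi2 q = 0.
Proof. intros H. unfold chi, chi1, chi2. rewrite clip_le0 by lra. repeat split; ring. Qed.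

Lemma chi_high (q : R) : 1 <= q -> chi q = 1 /\ chi1 q = 0 /\ chi2 q = 0.
Proof. intros H. unfold chi, chi1, chi2. rewrite clip_ge1 by lra. repeat split; ring. Qed.

Lemma chi_range (q : R) : 0 <= chi q <= 1.
Proof.
  unfold chi. assert (H := clip_range (2 * q - 1)). set (x := clip (2 * q - 1)) in *.
  cbv zeta. split.
  - apply Rmult_le_pos; [apply pow_le; lra | nra].
  - assert (E : 1 - x ^ 3 * (10 - 15 * x + 6 * x ^ 2)
      = (1 - x) ^ 3 * (6 * x ^ 2 + 3 * x + 1)) by ring.
    assert (0 <= (1 - x) ^ 3 * (6 * x ^ 2 + 3 * x + 1)).
    { apply Rmult_le_pos; [apply pow_le; lra | nra]. }
    lra.
Qed.

Lemma chi1_range (q : R) : 0 <= chi1 q <= 4.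
Proof.
  unfold chi1. assert (H := clip_range (2 * q - 1)). set (x := clip (2 * q - 1)) in *.
  cbv zeta. assert (K : 0 <= x * (1 - x)) by (apply Rmult_le_pos; lra).
  assert (K' : x * (1 - x) <= 1 / 4) by (generalize (pow2_ge_0 (x - 1 / 2)); lra).
  assert (K2 : x * (1 - x) * (x * (1 - x)) <= 1 / 4 * (1 / 4))
    by (apply Rmult_le_compat; lra).
  assert (K3 := Rmult_le_pos _ _ K K). simpl. rewrite Rmult_1_r. lra.
Qed.

(** * Explicit functions of t and r^2 *)


(** With [retarded_mm], the first two derivatives in m of the retarded time t - sqrt m. *)
Definition retarded_m (m : R) : R := - / (2 * sqrt m).
Definition retarded_mm (m : R) : R := / (4 * m * sqrt m).

Definition cut (t m : R) : R := chi (t - sqrt m).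
Definition cut_t (t m : R) : R := chi1 (t - sqrt m).
Definition cut_m (t m : R) : R := chi1 (t - sqrt m) * retarded_m m.
Definition cut_tt (t m : R) : R := chi2 (t - sqrt m).
Definition cut_tm (t m : R) : R := chi2 (t - sqrt m) * retarded_m m.
Definition cut_mm (t m : R) : R :=
  chi2 (t - sqrt m) * retarded_m m * retarded_m m + chi1 (t - sqrt m) * retarded_mm m.

Lemma retarded_continuous (t m : R) :
  continuous (fun q : R * R => fst q - sqrt (snd q)) (t, m).
Proof.
  apply (continuous_Rminus (fun q : R * R => fst q) (fun q => sqrt (snd q))).
  - apply continuous_fst.
  - apply (continuous_comp snd sqrt); [apply continuous_snd | apply continuous_sqrt].
Qed.

Lemma retarded_diff2 (h dh : R -> R) (t m : R) :
  (forall q, is_derive h q (dh q)) -> 0 < m ->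
  diff2 (fun t m => h (t - sqrt m)) (fun t m => dh (t - sqrt m))
    (fun t m => dh (t - sqrt m) * retarded_m m) t m.
Proof.
  intros Hh Hm. assert (Hs := sqrt_lt_R0 m Hm). split.
  - replace (dh (t - sqrt m)) with (1 * dh (t - sqrt m)) by ring.
    apply (is_derive_comp h (fun z => z - sqrt m)); [apply Hh |].
    auto_derive; [exact I | ring].
  - rewrite Rmult_comm.
    apply (is_derive_comp h (fun z => t - sqrt z)); [apply Hh |].
    unfold retarded_m. auto_derive; [exact Hm | field; lra].
Qed.

Lemma retarded_m_derive (m : R) : 0 < m -> is_derive retarded_m m (retarded_mm m).
Proof.
  intros Hm. assert (Hs := sqrt_lt_R0 m Hm). unfold retarded_m, retarded_mm.
  auto_derive; [split; [exact Hm | split; [lra | exact I]] |].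
  assert (E : m = sqrt m * sqrt m) by (symmetry; apply sqrt_sqrt; lra).
  revert Hs E. generalize (sqrt m). intros s Hs E. rewrite E. field. lra.
Qed.

(** For m > 0 this is the chain rule. At m = 0 the condition t > 1 puts a whole neighborhood where t
    - sqrt m > 1, and there the cut-off is identically 1. *)
Lemma cut_C2 (t m : R) : 1 < t -> 0 <= m -> C2_at cut cut_t cut_m cut_tt cut_tm cut_mm t m.
Proof.
  intros Ht Hm.
  assert (Cr := retarded_continuous t m).
  destruct (Rle_lt_or_eq_dec 0 m Hm) as [Hp | E0].
  - assert (Hs := sqrt_lt_R0 m Hp).
    assert (Ck : continuous (fun q : R * R => retarded_m (snd q)) (t, m)).
    { apply (continuous_comp snd retarded_m); [apply continuous_snd |].
      apply (is_derive_continuous_R _ _ _ (retarded_m_derive m Hp)). }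
    assert (Ck1 : continuous (fun q : R * R => retarded_mm (snd q)) (t, m)).
    { apply (continuous_comp snd retarded_mm); [apply continuous_snd |].
      apply (continuous_Rinv_comp (fun m => 4 * m * sqrt m)); simpl snd.
      - apply (continuous_Rmult (fun m => 4 * m) sqrt); [| apply continuous_sqrt].
        apply (continuous_Rmult (fun _ => 4) (fun m => m)); cont.
      - apply Rgt_not_eq. apply Rmult_lt_0_compat; lra. }
    assert (Ch : forall h : R -> R, (forall q, continuous h q) ->
      continuous (fun q : R * R => h (fst q - sqrt (snd q))) (t, m)).
    { intros h Hh. exact (continuous_Rcomp (fun q : R * R => fst q - sqrt (snd q)) h _ Hh Cr). }
    assert (C0 := Ch chi (fun q => is_derive_continuous_R _ _ _ (chi_derive q))).
    assert (C1 := Ch chi1 (fun q => is_derive_continuous_R _ _ _ (chi1_derive q))).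
    assert (C2 := Ch chi2 chi2_continuous).
    assert (D0 := retarded_diff2 chi chi1 t m chi_derive Hp).
    assert (D1 := retarded_diff2 chi1 chi2 t m chi1_derive Hp).
    split.
    + exact D0.
    + exact D1.
    + split; unfold cut_m, cut_tm, cut_mm.
      * replace (chi2 (t - sqrt m) * retarded_m m)
          with (chi2 (t - sqrt m) * retarded_m m + chi1 (t - sqrt m) * 0) by ring.
        apply (is_derive_mult_R (fun z => chi1 (z - sqrt m)) (fun _ => retarded_m m)).
        -- apply D1.
        -- apply @is_derive_const.
      * apply (is_derive_mult_R (fun z => chi1 (t - sqrt z)) retarded_m).
        -- apply D1.
        -- apply retarded_m_derive, Hp.
    + unfold cont2, cut, cut_t, cut_m, cut_tt, cut_tm, cut_mm.
      repeat split; cont; assumption.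
  - subst m. apply (C2_at_locally_const 1).
    assert (L : locally (t, 0) (fun q : R * R => 1 < fst q - sqrt (snd q))).
    { apply (Cr (fun z => 1 < z)). simpl. rewrite sqrt_0, Rminus_0_r.
      assert (Hd : 0 < t - 1) by lra. exists (mkposreal _ Hd). intros y Hy.
      change (Rabs (y - t) < t - 1) in Hy. apply Rabs_def2 in Hy. lra. }
    revert L. apply filter_imp. intros [t' m'] Hq.
    change (1 < t' - sqrt m') in Hq. cbv beta. simpl fst. simpl snd.
    destruct (chi_high (t' - sqrt m') (Rlt_le _ _ Hq)) as (e0 & e1 & e2).
    unfold cut, cut_t, cut_m, cut_tt, cut_tm, cut_mm. rewrite e0, e1, e2.
    repeat split; ring.
Qed.

(** * The powers t^a (t^2 - r^2)^b and the explicit solution with positive initial velocity *)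

Definition pw (a b t m : R) : R := Rpower t a * Rpower (t ^ 2 - m) b.

Definition pw_t (a b t m : R) : R := a * pw (a - 1) b t m + 2 * b * pw (a + 1) (b - 1) t m.
Definition pw_m (a b t m : R) : R := - b * pw a (b - 1) t m.
Definition pw_tt (a b t m : R) : R :=
  a * ((a - 1) * pw (a - 2) b t m + 2 * b * pw a (b - 1) t m)
  + 2 * b * ((a + 1) * pw a (b - 1) t m + 2 * (b - 1) * pw (a + 2) (b - 2) t m).
Definition pw_tm (a b t m : R) : R :=
  - b * (a * pw (a - 1) (b - 1) t m + 2 * (b - 1) * pw (a + 1) (b - 2) t m).
Definition pw_mm (a b t m : R) : R := b * (b - 1) * pw a (b - 2) t m.

Lemma Rpower_derive (x b : R) :
  0 < x -> is_derive (fun z => Rpower z b) x (b * Rpower x (b - 1)).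
Proof. intros Hx. apply is_derive_Reals, derivable_pt_lim_power, Hx. Qed.

Lemma pw_succ_l (a b t m : R) : 0 < t -> pw (a + 1) b t m = t * pw a b t m.
Proof. intros Ht. unfold pw. rewrite Rpower_plus, (Rpower_1 t Ht). ring. Qed.

Lemma pw_succ_r (a b t m : R) : 0 < t ^ 2 - m -> pw a (b + 1) t m = (t ^ 2 - m) * pw a b t m.
Proof. intros Ht. unfold pw. rewrite Rpower_plus, (Rpower_1 _ Ht). ring. Qed.

Lemma pw_diff2 (a b t m : R) :
  0 < t -> 0 < t ^ 2 - m -> diff2 (pw a b) (pw_t a b) (pw_m a b) t m.
Proof.
  intros Ht Hs. split; unfold pw_t, pw_m.
  - rewrite pw_succ_l by exact Ht. unfold pw.
    replace (a * (Rpower t (a - 1) * Rpower (t ^ 2 - m) b)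
        + 2 * b * (t * (Rpower t a * Rpower (t ^ 2 - m) (b - 1))))
      with (a * Rpower t (a - 1) * Rpower (t ^ 2 - m) b
        + Rpower t a * (2 * t * (b * Rpower (t ^ 2 - m) (b - 1)))) by ring.
    apply (is_derive_mult_R (fun z => Rpower z a) (fun z => Rpower (z ^ 2 - m) b)).
    + apply Rpower_derive, Ht.
    + apply (is_derive_comp (fun z => Rpower z b) (fun z => z ^ 2 - m)).
      * apply Rpower_derive, Hs.
      * auto_derive; [exact I | ring].
  - unfold pw.
    replace (- b * (Rpower t a * Rpower (t ^ 2 - m) (b - 1)))
      with (Rpower t a * (-1 * (b * Rpower (t ^ 2 - m) (b - 1)))) by ring.
    apply (is_derive_scal (fun z => Rpower (t ^ 2 - z) b)).
    apply (is_derive_comp (fun z => Rpower z b) (fun z => t ^ 2 - z)).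
    + apply Rpower_derive, Hs.
    + auto_derive; [exact I | ring].
Qed.

Lemma pw_continuous (a b t m : R) : 0 < t -> 0 < t ^ 2 - m -> cont2 (pw a b) t m.
Proof.
  intros Ht Hs. unfold cont2, pw. apply continuous_Rmult.
  - apply (continuous_comp fst (fun z => Rpower z a)); [apply continuous_fst |].
    apply (is_derive_continuous_R _ _ _ (Rpower_derive t a Ht)).
  - apply (continuous_comp (fun q : R * R => fst q ^ 2 - snd q) (fun z => Rpower z b)).
    + apply (continuous_ext (fun q : R * R => fst q * fst q - snd q)).
      { intros q. simpl. ring. }
      cont.
    + apply (is_derive_continuous_R _ _ _ (Rpower_derive _ b Hs)).
Qed.

Lemma diff2_scal (c : R) (g gt gm : R -> R -> R) (t m : R) :
  diff2 g gt gm t m ->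
  diff2 (fun t m => c * g t m) (fun t m => c * gt t m) (fun t m => c * gm t m) t m.
Proof. intros [H1 H2]. split; apply is_derive_scal; assumption. Qed.

Lemma pw_C2 (a b t m : R) :
  0 < t -> 0 < t ^ 2 - m ->
  C2_at (pw a b) (pw_t a b) (pw_m a b) (pw_tt a b) (pw_tm a b) (pw_mm a b) t m.
Proof.
  intros Ht Hs. assert (C := fun a b => pw_continuous a b t m Ht Hs).
  assert (D := fun a b => pw_diff2 a b t m Ht Hs).
  split.
  - apply D.
  - eapply diff2_eq; [| | apply diff2_plus; apply diff2_scal; apply D];
    cbv beta; unfold pw_t, pw_m, pw_tt, pw_tm;
    replace (a - 1 - 1) with (a - 2) by ring; replace (a - 1 + 1) with a by ring;
    replace (a + 1 - 1) with a by ring; replace (a + 1 + 1) with (a + 2) by ring;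
    replace (b - 1 - 1) with (b - 2) by ring; ring.
  - eapply diff2_eq; [| | apply diff2_scal; apply D];
    cbv beta; unfold pw_t, pw_m, pw_tm, pw_mm;
    replace (b - 1 - 1) with (b - 2) by ring; ring.
  - unfold cont2 in *. unfold pw_t, pw_m, pw_tt, pw_tm, pw_mm. repeat split; cont; apply C.
Qed.

Lemma pw_wave (a b t m : R) :
  0 < t -> 0 < t ^ 2 - m ->
  pw_tt a b t m - 4 * m * pw_mm a b t m - 6 * pw_m a b t m
  = a * (a - 1) * pw (a - 2) b t m + 4 * b * (a + b + 1) * pw a (b - 1) t m.
Proof.
  intros Ht Hs. unfold pw_tt, pw_mm, pw_m.
  replace (a + 2) with (a + 1 + 1) by ring. rewrite !(pw_succ_l (a + 1)), !(pw_succ_l a) by exact Ht.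
  replace (b - 1) with (b - 2 + 1) by ring. rewrite pw_succ_r by exact Hs. ring.
Qed.

(** The left side is (d_t + d_r)(r V) for V the power, since 2 r d_m = d_r. The operator d_t + d_r
    annihilates t - r, so in s = (t - r)(t + r) only t + r contributes, with logarithmic derivative
    2 / (t + r). *)
Lemma pw_outgoing (a b t r : R) :
  0 <= r < t ->
  pw a b t (r ^ 2) + r * pw_t a b t (r ^ 2) + 2 * r ^ 2 * pw_m a b t (r ^ 2)
  = pw a b t (r ^ 2) * (1 + a * r / t + 2 * b * r / (t + r)).
Proof.
  intros Hr. assert (Ht : 0 < t) by lra. assert (Hs : 0 < t ^ 2 - r ^ 2) by nra.
  unfold pw_t, pw_m. rewrite pw_succ_l by exact Ht.
  replace (pw a b t (r ^ 2)) with (t * pw (a - 1) b t (r ^ 2)).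
  2:{ rewrite <- pw_succ_l by exact Ht. f_equal; ring. }
  replace (pw a (b - 1) t (r ^ 2)) with (t * pw (a - 1) (b - 1) t (r ^ 2)).
  2:{ rewrite <- pw_succ_l by exact Ht. f_equal; ring. }
  replace (pw (a - 1) b t (r ^ 2)) with ((t ^ 2 - r ^ 2) * pw (a - 1) (b - 1) t (r ^ 2)).
  2:{ rewrite <- pw_succ_r by exact Hs. f_equal; ring. }
  field. lra.
Qed.

(* conf(t, |x|^2) is the imaginary part of 1/(|x|^2 - (t - 2 + i)^2), up to a factor: a positive
   global solution of the wave equation with data 0 and (1 + |x|^2)^(-2) at t = 2. *)
Definition conf_den (t m : R) : R := (m - (t - 2) ^ 2 + 1) ^ 2 + 4 * (t - 2) ^ 2.
Definition conf_den_t (t m : R) : R := 4 * (t - 2) * (1 + (t - 2) ^ 2 - m).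
Definition conf_den_m (t m : R) : R := 2 * (m - (t - 2) ^ 2 + 1).
Definition conf_den_tt (t m : R) : R := 4 * (1 + (t - 2) ^ 2 - m) + 8 * (t - 2) ^ 2.

Definition conf (t m : R) : R := (t - 2) * / conf_den t m.
Definition conf_t (t m : R) : R :=
  / conf_den t m - (t - 2) * conf_den_t t m * / conf_den t m * / conf_den t m.
Definition conf_m (t m : R) : R :=
  - ((t - 2) * conf_den_m t m * / conf_den t m * / conf_den t m).
Definition conf_tt (t m : R) : R :=
  - (2 * conf_den_t t m * / conf_den t m * / conf_den t m)
  - (t - 2) * conf_den_tt t m * / conf_den t m * / conf_den t m
  + 2 * (t - 2) * conf_den_t t m * conf_den_t t m * / conf_den t m * / conf_den t m * / conf_den t m.
Definition conf_tm (t m : R) : R :=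
  - (conf_den_m t m * / conf_den t m * / conf_den t m)
  + (t - 2) * (4 * (t - 2)) * / conf_den t m * / conf_den t m
  + 2 * (t - 2) * conf_den_m t m * conf_den_t t m * / conf_den t m * / conf_den t m * / conf_den t m.
Definition conf_mm (t m : R) : R :=
  - ((t - 2) * 2 * / conf_den t m * / conf_den t m)
  + 2 * (t - 2) * conf_den_m t m * conf_den_m t m * / conf_den t m * / conf_den t m * / conf_den t m.

Lemma conf_den_pos (t m : R) : 0 <= m -> 0 < conf_den t m.
Proof.
  intros Hm. unfold conf_den. destruct (Req_dec (t - 2) 0) as [E | E].
  - rewrite E. nra.
  - assert (0 < (t - 2) ^ 2) by (rewrite <- Rsqr_pow2; apply Rsqr_pos_lt, E).
    assert (0 <= (m - (t - 2) ^ 2 + 1) ^ 2) by apply pow2_ge_0. lra.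
Qed.

Lemma conf_C2 (t m : R) : 0 <= m -> C2_at conf conf_t conf_m conf_tt conf_tm conf_mm t m.
Proof.
  intros Hm. assert (Hz := conf_den_pos t m Hm).
  assert (Cd : continuous (fun q : R * R => / conf_den (fst q) (snd q)) (t, m)).
  { apply (continuous_comp (fun q : R * R => conf_den (fst q) (snd q)) Rinv);
      [| apply continuous_Rinv, Rgt_not_eq, Hz]. unfold conf_den.
    apply (continuous_ext (fun q : R * R =>
      (snd q - (fst q - 2) * (fst q - 2) + 1) * (snd q - (fst q - 2) * (fst q - 2) + 1)
      + 4 * ((fst q - 2) * (fst q - 2)))).
    { intros q. simpl. ring. }
    cont. }
  assert (Ct : continuous (fun q : R * R => conf_den_t (fst q) (snd q)) (t, m)).
  { unfold conf_den_t. simpl. cont. }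
  assert (Cm : continuous (fun q : R * R => conf_den_m (fst q) (snd q)) (t, m)).
  { unfold conf_den_m. simpl. cont. }
  assert (Ctt : continuous (fun q : R * R => conf_den_tt (fst q) (snd q)) (t, m)).
  { unfold conf_den_tt. simpl. cont. }
  split.
  - split; unfold conf, conf_t, conf_m, conf_den_t, conf_den_m, conf_den in *;
      auto_derive;
      try (split; [lra | exact I]); try (apply Rgt_not_eq; exact Hz); field; lra.
  - split; unfold conf_t, conf_tt, conf_tm, conf_den_tt, conf_den_t, conf_den_m, conf_den in *;
      auto_derive;
      try (apply Rgt_not_eq; exact Hz); repeat split; try (apply Rgt_not_eq; exact Hz);
      field; lra.
  - split; unfold conf_m, conf_tm, conf_mm, conf_den_t, conf_den_m, conf_den in *;
      auto_derive;
      try (apply Rgt_not_eq; exact Hz); repeat split; try (apply Rgt_not_eq; exact Hz);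
      field; lra.
  - unfold cont2, conf, conf_t, conf_m, conf_tt, conf_tm, conf_mm. repeat split; cont; assumption.
Qed.

Lemma conf_wave (t m : R) :
  0 <= m -> conf_tt t m - 4 * m * conf_mm t m - 6 * conf_m t m = 0.
Proof.
  intros Hm. assert (Hz := conf_den_pos t m Hm).
  unfold conf_tt, conf_mm, conf_m, conf_den_t, conf_den_m, conf_den_tt, conf_den in *. field. lra.
Qed.

(** * The barrier *)


Lemma radius_sqnorm (p : R * R * R * R) : radius p = sqrt (sqnorm p).
Proof. destruct p as [[[t x1] x2] x3]; reflexivity. Qed.

Lemma radius_nonneg (p : R * R * R * R) : 0 <= radius p.
Proof. rewrite radius_sqnorm. apply sqrt_pos. Qed.

Lemma radius_sq (p : R * R * R * R) : radius p ^ 2 = sqnorm p.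
Proof. rewrite radius_sqnorm. apply pow2_sqrt, sqnorm_nonneg. Qed.

(** Cauchy-Schwarz through Lagrange's identity; the sum of squares is that of the cross product. *)
Lemma inner_le_radius (t x1 x2 x3 a b c : R) :
  a * a + b * b + c * c = 1 ->
  Rabs (a * x1 + b * x2 + c * x3) <= radius (t, x1, x2, x3).
Proof.
  intros H. unfold radius. rewrite <- sqrt_Rsqr_abs. apply sqrt_le_1_alt. unfold Rsqr.
  assert (0 <= (a * x2 - b * x1) ^ 2 + (a * x3 - c * x1) ^ 2 + (b * x3 - c * x2) ^ 2)
    by (generalize (pow2_ge_0 (a * x2 - b * x1)), (pow2_ge_0 (a * x3 - c * x1)),
          (pow2_ge_0 (b * x3 - c * x2)); lra).
  replace (x1 ^ 2 + x2 ^ 2 + x3 ^ 2) with ((a * a + b * b + c * c) * (x1 ^ 2 + x2 ^ 2 + x3 ^ 2))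
    by (rewrite H; ring).
  nra.
Qed.

(** The factor v need only be regular inside the light cone m < t^2. On and outside it t - sqrt m <=
    0, so the cut-off and all its derivatives vanish nearby and the values of v are irrelevant. *)
Lemma cut_mult_C2 (v vt vm vtt vtm vmm : R -> R -> R) (t m : R) :
  (m < t ^ 2 -> C2_at v vt vm vtt vtm vmm t m) ->
  1 < t -> 0 <= m ->
  C2_at (fun t m => cut t m * v t m)
    (fun t m => cut_t t m * v t m + cut t m * vt t m)
    (fun t m => cut_m t m * v t m + cut t m * vm t m)
    (fun t m => cut_tt t m * v t m + 2 * (cut_t t m * vt t m) + cut t m * vtt t m)
    (fun t m => cut_tm t m * v t m + cut_t t m * vm t m + cut_m t m * vt t m
       + cut t m * vtm t m)
    (fun t m => cut_mm t m * v t m + 2 * (cut_m t m * vm t m) + cut t m * vmm t m) t m.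
Proof.
  intros Hv Ht Hm. destruct (Rlt_le_dec m (t ^ 2)) as [H | H].
  - apply C2_at_mult; [apply cut_C2; assumption | apply Hv, H].
  - apply (C2_at_locally_const 0).
    assert (Hq : t - sqrt m < 1 / 2).
    { assert (t <= sqrt m).
      { replace t with (sqrt (t ^ 2)) by (apply sqrt_pow2; lra). apply sqrt_le_1_alt, H. }
      lra. }
    assert (L : locally (t, m) (fun q : R * R => fst q - sqrt (snd q) < 1 / 2)).
    { apply (retarded_continuous t m (fun z => z < 1 / 2)). simpl.
      assert (Hd : 0 < 1 / 2 - (t - sqrt m)) by lra. exists (mkposreal _ Hd). intros y Hy.
      change (Rabs (y - (t - sqrt m)) < 1 / 2 - (t - sqrt m)) in Hy.
      apply Rabs_def2 in Hy. lra. }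
    revert L. apply filter_imp. intros [t' m'] Hq'.
    change (t' - sqrt m' < 1 / 2) in Hq'. cbv beta. simpl fst. simpl snd.
    destruct (chi_low (t' - sqrt m') (Rlt_le _ _ Hq')) as (e0 & e1 & e2).
    unfold cut, cut_t, cut_m, cut_tt, cut_tm, cut_mm. rewrite e0, e1, e2.
    repeat split; ring.
Qed.

(* Since d_t q = - d_r q for q = t - r, the second derivative of the cut-off cancels and
   only the outgoing derivative (d_t + d_r)(r v) is left over. *)
Lemma cut_mult_wave (v vt vm vtt vmm t r : R) :
  0 < r ->
  cut_tt t (r ^ 2) * v + 2 * (cut_t t (r ^ 2) * vt) + cut t (r ^ 2) * vtt
  - 4 * r ^ 2 * (cut_mm t (r ^ 2) * v + 2 * (cut_m t (r ^ 2) * vm) + cut t (r ^ 2) * vmm)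
  - 6 * (cut_m t (r ^ 2) * v + cut t (r ^ 2) * vm)
  = cut t (r ^ 2) * (vtt - 4 * r ^ 2 * vmm - 6 * vm)
    + 2 * (chi1 (t - r) / r) * (v + r * vt + 2 * r ^ 2 * vm).
Proof.
  intros Hr. unfold cut, cut_t, cut_m, cut_tt, cut_mm, retarded_m, retarded_mm.
  rewrite (sqrt_pow2 r) by lra. field. lra.
Qed.

Lemma cut_low (t m : R) : t - sqrt m <= 1 / 2 ->
  cut t m = 0 /\ cut_t t m = 0 /\ cut_m t m = 0 /\ cut_tt t m = 0 /\ cut_mm t m = 0.
Proof.
  intros H. destruct (chi_low _ H) as (e0 & e1 & e2).
  unfold cut, cut_t, cut_m, cut_tt, cut_mm. rewrite e0, e1, e2. repeat split; ring.
Qed.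

Lemma cut_high (t m : R) : 1 <= t - sqrt m ->
  cut t m = 1 /\ cut_t t m = 0 /\ cut_m t m = 0 /\ cut_tt t m = 0 /\ cut_mm t m = 0.
Proof.
  intros H. destruct (chi_high _ H) as (e0 & e1 & e2).
  unfold cut, cut_t, cut_m, cut_tt, cut_mm. rewrite e0, e1, e2. repeat split; ring.
Qed.

Lemma conf_initial (m : R) : 0 <= m ->
  conf 2 m = 0 /\ conf_t 2 m = / (m + 1) ^ 2 /\ conf_m 2 m = 0.
Proof.
  intros Hm. unfold conf, conf_t, conf_m, conf_den_t, conf_den_m, conf_den. repeat split; field; lra.
Qed.

(** Here e stands for omega . x. The four cut-off terms are at least -(16 + 12 + 16 + 6) M = -50 M,
    and (r^2 + 1)^2 <= 12 for r < 3/2, so 600 = 50 * 12 suffices. For r >= 3/2 the cut-off vanishes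
    at t = 2. *)
Lemma cut_initial_slope (v vt vm M r e : R) :
  0 <= r < 3 / 2 -> 0 <= M -> Rabs v <= 4 * M -> Rabs vt <= 12 * M -> Rabs vm <= 2 * M ->
  Rabs e <= r ->
  0 <= cut_t 2 (r ^ 2) * v + cut 2 (r ^ 2) * vt + 600 * M * / (r ^ 2 + 1) ^ 2
    + 2 * e * (cut_m 2 (r ^ 2) * v + cut 2 (r ^ 2) * vm).
Proof.
  intros Hr HM Hv Hvt Hvm He.
  assert (Hc := chi_range (2 - r)). assert (Hc1 := chi1_range (2 - r)).
  (* For r > 0 this is chi1 |e| / r, with |e| <= r and chi1 <= 4. At r = 0, where the derivative of
     sqrt has no meaning, chi1 is zero. *)
  assert (Kr : Rabs (2 * e * cut_m 2 (r ^ 2)) <= 4).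
  { unfold cut_m, retarded_m. rewrite (sqrt_pow2 r) by lra.
    destruct (Req_dec r 0) as [E | E].
    - subst r. destruct (chi_high (2 - 0)) as (_ & e1 & _); [lra |].
      rewrite e1, Rmult_0_l, Rmult_0_r, Rabs_R0. lra.
    - replace (2 * e * (chi1 (2 - r) * - / (2 * r))) with (- (chi1 (2 - r) * (e * / r)))
        by (field; lra).
      rewrite Rabs_Ropp, Rabs_mult, (Rabs_pos_eq (chi1 _)) by lra.
      assert (Rabs (e * / r) <= 1).
      { rewrite Rabs_mult, (Rabs_pos_eq (/ r)) by (left; apply Rinv_0_lt_compat; lra).
        apply Rmult_le_reg_r with r; [lra |]. rewrite Rmult_assoc, Rinv_l by exact E. lra. }
      generalize (Rabs_pos (e * / r)). nra. }
  assert (Ka : Rabs (2 * e * cut 2 (r ^ 2)) <= 3).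
  { unfold cut. rewrite (sqrt_pow2 r) by lra.
    rewrite !Rabs_mult, (Rabs_pos_eq 2), (Rabs_pos_eq (chi _)) by lra.
    generalize (Rabs_pos e). nra. }
  assert (prod : forall x y X Y, Rabs x <= X -> Rabs y <= Y -> - (X * Y) <= x * y).
  { intros x y X Y Hx Hy. assert (Hxy : Rabs (x * y) <= X * Y).
    { rewrite Rabs_mult. apply Rmult_le_compat; auto using Rabs_pos. }
    apply Rabs_le_between in Hxy. lra. }
  assert (T1 := prod (cut_t 2 (r ^ 2)) v 4 (4 * M)).
  assert (T2 := prod (cut 2 (r ^ 2)) vt 1 (12 * M)).
  assert (T3 := prod _ v 4 (4 * M) Kr Hv).
  assert (T4 := prod _ vm 3 (2 * M) Ka Hvm).
  assert (T1' : - (4 * (4 * M)) <= cut_t 2 (r ^ 2) * v).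
  { apply T1; [| exact Hv]. unfold cut_t. rewrite (sqrt_pow2 r), Rabs_pos_eq by lra. lra. }
  assert (T2' : - (1 * (12 * M)) <= cut 2 (r ^ 2) * vt).
  { apply T2; [| exact Hvt]. unfold cut. rewrite (sqrt_pow2 r), Rabs_pos_eq by lra. lra. }
  assert (T5 : 50 * M <= 600 * M * / (r ^ 2 + 1) ^ 2).
  { assert (Hp : 0 < (r ^ 2 + 1) ^ 2) by (apply pow_lt; nra).
    apply Rmult_le_reg_r with ((r ^ 2 + 1) ^ 2); [exact Hp |].
    replace (600 * M * / (r ^ 2 + 1) ^ 2 * (r ^ 2 + 1) ^ 2) with (600 * M) by (field; nra).
    assert (r ^ 2 <= 9 / 4) by nra. assert (0 <= r ^ 2) by nra.
    assert ((r ^ 2 + 1) ^ 2 <= 12) by nra. nra. }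
  replace (2 * e * (cut_m 2 (r ^ 2) * v + cut 2 (r ^ 2) * vm))
    with (2 * e * cut_m 2 (r ^ 2) * v + 2 * e * cut 2 (r ^ 2) * vm) by ring.
  lra.
Qed.

(** Isolates what a profile v must satisfy: nonnegative value, nonnegative outgoing derivative of r
    v, -Box v nonnegative everywhere in {r < t} and above the source in K, and C^1 data at t = 2 of
    size M where the cut-off lives. In K the cut-off is 1, so the bound only sees v and the
    compensator. *)
Lemma barrier (v vt vm vtt vtm vmm : R -> R -> R) (M : R) (u : R * R * R * R -> R)
    (p : R * R * R * R) :
  (forall t m, 0 < t -> 0 <= m -> m < t ^ 2 -> C2_at v vt vm vtt vtm vmm t m) ->
  (forall t r, 2 <= t -> 0 <= r < t -> 0 <= v t (r ^ 2)) ->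
  (forall t r, 2 <= t -> 0 <= r < t ->
     0 <= v t (r ^ 2) + r * vt t (r ^ 2) + 2 * r ^ 2 * vm t (r ^ 2)) ->
  (forall t r, 2 <= t -> 0 <= r < t ->
     0 <= vtt t (r ^ 2) - 4 * r ^ 2 * vmm t (r ^ 2) - 6 * vm t (r ^ 2)) ->
  0 <= M ->
  (forall r, 0 <= r < 3 / 2 -> Rabs (v 2 (r ^ 2)) <= 4 * M /\ Rabs (vt 2 (r ^ 2)) <= 12 * M /\
     Rabs (vm 2 (r ^ 2)) <= 2 * M) ->
  classical_regularity u ->
  (forall x1 x2 x3, u (2, x1, x2, x3) = 0) ->
  (forall x1 x2 x3, is_initial_dt u x1 x2 x3 0) ->
  (forall q, 2 < time q -> ~ K q -> Box u q = 0) ->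
  (forall q, 2 < time q -> K q -> Rabs (Box u q) <=
     vtt (time q) (radius q ^ 2) - 4 * radius q ^ 2 * vmm (time q) (radius q ^ 2)
     - 6 * vm (time q) (radius q ^ 2)) ->
  2 < time p -> K p ->
  Rabs (u p) <= v (time p) (radius p ^ 2) + 600 * M * conf (time p) (radius p ^ 2).
Proof.
  intros HC HV HE HD HM Hbd Hu Hu0 Hdt HK Hf Hp HKp.
  set (w := fun t m => cut t m * v t m + 600 * M * conf t m).
  set (wt := fun t m => cut_t t m * v t m + cut t m * vt t m + 600 * M * conf_t t m).
  set (wm := fun t m => cut_m t m * v t m + cut t m * vm t m + 600 * M * conf_m t m).
  set (wtt := fun t m => cut_tt t m * v t m + 2 * (cut_t t m * vt t m) + cut t m * vtt t m
     + 600 * M * conf_tt t m).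
  set (wtm := fun t m => cut_tm t m * v t m + cut_t t m * vm t m + cut_m t m * vt t m
       + cut t m * vtm t m + 600 * M * conf_tm t m).
  set (wmm := fun t m => cut_mm t m * v t m + 2 * (cut_m t m * vm t m) + cut t m * vmm t m
     + 600 * M * conf_mm t m).
  (* Starting at t = 1 leaves room below the initial slice, where the partials of the barrier are
     then ordinary ones. *)
  destruct (rad_C2 1 w wt wm wtt wtm wmm) as [WC [WG WB]].
  { intros t m Ht Hm. apply (C2_at_plus (fun t m => cut t m * v t m)
      (fun t m => cut_t t m * v t m + cut t m * vt t m)
      (fun t m => cut_m t m * v t m + cut t m * vm t m)
      (fun t m => cut_tt t m * v t m + 2 * (cut_t t m * vt t m) + cut t m * vtt t m)
      (fun t m => cut_tm t m * v t m + cut_t t m * vm t m + cut_m t m * vt t m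
         + cut t m * vtm t m)
      (fun t m => cut_mm t m * v t m + 2 * (cut_m t m * vm t m) + cut t m * vmm t m)).
    - apply cut_mult_C2; [| exact Ht | exact Hm]. intros H. apply HC; lra.
    - apply C2_at_scal, conf_C2, Hm. }
  assert (WB' : forall q, 2 <= time q -> - Box (rad w) q =
     cut_tt (time q) (radius q ^ 2) * v (time q) (radius q ^ 2)
     + 2 * (cut_t (time q) (radius q ^ 2) * vt (time q) (radius q ^ 2))
     + cut (time q) (radius q ^ 2) * vtt (time q) (radius q ^ 2)
     - 4 * radius q ^ 2 * (cut_mm (time q) (radius q ^ 2) * v (time q) (radius q ^ 2)
        + 2 * (cut_m (time q) (radius q ^ 2) * vm (time q) (radius q ^ 2))
        + cut (time q) (radius q ^ 2) * vmm (time q) (radius q ^ 2))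
     - 6 * (cut_m (time q) (radius q ^ 2) * v (time q) (radius q ^ 2)
        + cut (time q) (radius q ^ 2) * vm (time q) (radius q ^ 2))).
  { intros q Hq. rewrite WB by lra. rewrite <- radius_sq.
    assert (Z := conf_wave (time q) (radius q ^ 2) (pow2_ge_0 _)).
    unfold wtt, wmm, wm.
    replace (conf_tt (time q) (radius q ^ 2)) with
      (4 * radius q ^ 2 * conf_mm (time q) (radius q ^ 2) + 6 * conf_m (time q) (radius q ^ 2)) by lra.
    ring. }
  assert (sqr : forall q, sqrt (radius q ^ 2) = radius q).
  { intros q. apply sqrt_pow2, radius_nonneg. }
  assert (B1 : forall q, 2 <= time q -> 1 <= time q - radius q -> - Box (rad w) q =
     vtt (time q) (radius q ^ 2) - 4 * radius q ^ 2 * vmm (time q) (radius q ^ 2)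
     - 6 * vm (time q) (radius q ^ 2)).
  { intros q Hq H1. rewrite (WB' q Hq).
    destruct (cut_high (time q) (radius q ^ 2)) as (e0 & e1 & e2 & e3 & e4).
    { rewrite sqr. exact H1. }
    rewrite e0, e1, e2, e3, e4. ring. }
  (* Three zones of t - r: above 1 the profile is uncut, below 1/2 it is zero. In between r > 1, and
     the outgoing derivative enters with the nonnegative factor 2 chi1 / r. *)
  assert (B0 : forall q, 2 <= time q -> Box (rad w) q <= 0).
  { intros q Hq. assert (Hr := radius_nonneg q).
    enough (0 <= - Box (rad w) q) by lra.
    destruct (Rle_lt_dec 1 (time q - radius q)) as [H1 | H1].
    - rewrite (B1 q Hq H1). apply HD; lra.
    - rewrite (WB' q Hq). destruct (Rle_lt_dec (time q - radius q) (1 / 2)) as [H2 | H2].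
      + destruct (cut_low (time q) (radius q ^ 2)) as (e0 & e1 & e2 & e3 & e4).
        { rewrite sqr. exact H2. }
        rewrite e0, e1, e2, e3, e4. right. ring.
      + rewrite cut_mult_wave by lra.
        apply Rplus_le_le_0_compat; apply Rmult_le_pos.
        * unfold cut. apply chi_range.
        * apply HD; lra.
        * apply Rmult_le_pos; [lra |]. apply Rmult_le_pos; [apply chi1_range |].
          left. apply Rinv_0_lt_compat. lra.
        * apply HE; lra. }
  assert (Main : forall s, s = 1 \/ s = -1 -> s * u p <= rad w p).
  { intros s Hs. apply (comparison 1 u (rad w) p s); try assumption.
    - lra.
    - intros q Hq. destruct (classic (K q)) as [HKq | HKq].
      + assert (Hq1 : 1 <= time q - radius q) by (unfold K in HKq; lra).
        assert (E := B1 q (Rlt_le _ _ Hq) Hq1). specialize (Hf q Hq HKq).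
        apply Rabs_le_between in Hf. destruct Hs; subst s; lra.
      + rewrite (HK q Hq HKq). generalize (B0 q (Rlt_le _ _ Hq)). lra.
    - intros q Hq. unfold rad, w. rewrite Hq, <- radius_sq.
      destruct (conf_initial (radius q ^ 2) (pow2_ge_0 _)) as (z0 & _).
      rewrite z0, Rmult_0_r, Rplus_0_r.
      destruct (Rlt_le_dec (radius q) 2) as [H | H].
      + apply Rmult_le_pos; [apply chi_range |]. apply HV; [lra |].
        split; [apply radius_nonneg | exact H].
      + destruct (cut_low 2 (radius q ^ 2)) as (e0 & _); [rewrite sqr; lra |].
        rewrite e0. lra.
    - intros q a b c Hq Habc. rewrite !WG by lra.
      assert (Hr := radius_nonneg q). assert (Hsq := radius_sq q). assert (Hs2 := sqr q).
      destruct q as [[[t x1] x2] x3]. simpl in Hq. subst t.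
      unfold rad_grad, rad. rewrite <- Hsq. simpl time. simpl coord.
      set (r := radius (2, x1, x2, x3)) in *.
      assert (He := inner_le_radius 2 x1 x2 x3 a b c Habc). fold r in He.
      destruct (conf_initial (r ^ 2) (pow2_ge_0 _)) as (_ & z1 & z2).
      unfold wt, wm. rewrite z1, z2.
      destruct (Rlt_le_dec r (3 / 2)) as [H | H].
      + destruct (Hbd r (conj Hr H)) as (b1 & b2 & b3).
        eapply Rle_trans; [apply (cut_initial_slope _ _ _ M r _ (conj Hr H) HM b1 b2 b3 He) |].
        right. ring.
      + destruct (cut_low 2 (r ^ 2)) as (e0 & e1 & e2 & _); [rewrite Hs2; lra |].
        rewrite e0, e1, e2.
        assert (0 <= 600 * M * / (r ^ 2 + 1) ^ 2).
        { apply Rmult_le_pos; [lra |]. left. apply Rinv_0_lt_compat, pow_lt. nra. }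
        lra. }
  assert (Ew : rad w p = v (time p) (radius p ^ 2) + 600 * M * conf (time p) (radius p ^ 2)).
  { unfold rad, w. rewrite <- radius_sq.
    destruct (cut_high (time p) (radius p ^ 2)) as (e0 & _).
    { rewrite sqr. unfold K in HKp. lra. }
    rewrite e0. ring. }
  rewrite <- Ew. apply Rabs_le_between.
  assert (M1 := Main 1 (or_introl eq_refl)). assert (M2 := Main (-1) (or_intror eq_refl)).
  lra.
Qed.

(** * Estimates *)


Lemma Rpower_pos (x b : R) : 0 < Rpower x b.
Proof. apply exp_pos. Qed.

Lemma Rpower_m1 (x : R) : 0 < x -> Rpower x (-1) = / x.
Proof. intros Hx. rewrite <- (Rpower_1 x Hx) at 2. apply (Rpower_Ropp x 1). Qed.

Lemma Rpower_dyadic (x b : R) : 1 <= x <= 2 -> -1 <= b <= 1 -> 1 / 2 <= Rpower x b <= 2.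
Proof.
  intros Hx Hb. split.
  - apply Rle_trans with (Rpower x (-1)); [| apply Rle_Rpower; lra].
    rewrite Rpower_m1 by lra. apply Rle_trans with (/ 2); [lra |].
    apply Rinv_le_contravar; lra.
  - apply Rle_trans with (Rpower x 1); [apply Rle_Rpower; lra |].
    rewrite Rpower_1; lra.
Qed.

Lemma pw_pos (a b t m : R) : 0 < pw a b t m.
Proof. apply Rmult_lt_0_compat; apply Rpower_pos. Qed.

(** Makes the comparison of s with t (t - r) exact: their quotient (t + r) / t lies in [1, 2], so
    for |b| <= 1 its power costs at most a factor 2 either way. *)
Lemma pw_factor (a b t r : R) :
  0 <= r < t ->
  pw a b t (r ^ 2) = Rpower t (a + b) * Rpower (t - r) b * Rpower ((t + r) / t) b.
Proof.
  intros Hr. unfold pw.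
  replace (t ^ 2 - r ^ 2) with (t * ((t + r) / t) * (t - r)) by (field; lra).
  assert (Hx : 0 < (t + r) / t) by (apply Rdiv_lt_0_compat; lra).
  assert (Ht : 0 < t) by lra. assert (Hq : 0 < t - r) by lra.
  assert (Hp : 0 < t * ((t + r) / t)) by (apply Rmult_lt_0_compat; assumption).
  rewrite <- (Rpower_mult_distr (t * ((t + r) / t)) (t - r)), <- (Rpower_mult_distr t), Rpower_plus
    by assumption.
  ring.
Qed.

Lemma ratio_range (t r : R) : 0 <= r < t -> 1 <= (t + r) / t <= 2.
Proof. intros Hr. split; [apply Rle_div_r | apply Rle_div_l]; lra. Qed.

Lemma pw_upper (a b t r : R) :
  0 <= r < t -> -1 <= b <= 1 ->
  pw a b t (r ^ 2) <= 2 * (Rpower t (a + b) * Rpower (t - r) b).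
Proof.
  intros Hr Hb. rewrite pw_factor by exact Hr.
  rewrite (Rmult_comm 2). apply Rmult_le_compat_l.
  - left. apply Rmult_lt_0_compat; apply Rpower_pos.
  - apply Rpower_dyadic; [apply ratio_range, Hr | exact Hb].
Qed.

Lemma pw_lower (a b t r : R) :
  0 <= r < t -> -1 <= b <= 1 ->
  1 / 2 * (Rpower t (a + b) * Rpower (t - r) b) <= pw a b t (r ^ 2).
Proof.
  intros Hr Hb. rewrite pw_factor by exact Hr.
  rewrite (Rmult_comm (1 / 2)). apply Rmult_le_compat_l.
  - left. apply Rmult_lt_0_compat; apply Rpower_pos.
  - apply Rpower_dyadic; [apply ratio_range, Hr | exact Hb].
Qed.

(** The two powers have the same homogeneity a + 2 b, and their quotient is (s / t^2)^nu <= 1. *)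
Lemma pw_compare (a b nu t r : R) :
  0 <= r < t -> 0 <= nu -> pw (a - 2 * nu) (b + nu) t (r ^ 2) <= pw a b t (r ^ 2).
Proof.
  intros Hr Hnu. unfold pw.
  assert (Hs : 0 < t ^ 2 - r ^ 2) by nra.
  replace (a - 2 * nu) with (a + - (2 * nu)) by ring. rewrite !Rpower_plus, Rpower_Ropp.
  assert (H : Rpower (t ^ 2 - r ^ 2) nu <= Rpower t (2 * nu)).
  { apply Rle_trans with (Rpower (t ^ 2) nu).
    - apply Rle_Rpower_l; [exact Hnu |]. nra.
    - right. replace (t ^ 2) with (Rpower t 2).
      + apply Rpower_mult.
      + rewrite <- Rpower_pow by lra. reflexivity. }
  assert (P1 := Rpower_pos t a). assert (P2 := Rpower_pos (t ^ 2 - r ^ 2) b).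
  assert (P3 := Rpower_pos t (2 * nu)).
  replace (Rpower t a * / Rpower t (2 * nu) * (Rpower (t ^ 2 - r ^ 2) b * Rpower (t ^ 2 - r ^ 2) nu))
    with (Rpower t a * Rpower (t ^ 2 - r ^ 2) b * (Rpower (t ^ 2 - r ^ 2) nu / Rpower t (2 * nu)))
    by (field; lra).
  rewrite <- (Rmult_1_r (Rpower t a * Rpower (t ^ 2 - r ^ 2) b)) at 2.
  apply Rmult_le_compat_l.
  - left. apply Rmult_lt_0_compat; assumption.
  - apply Rle_div_l; lra.
Qed.

(** For r < 3/2 both bases, 2 and 4 - r^2 > 7/4, exceed 1, so the powers increase with the exponents
    and upper bounds on a and b are enough. *)
Lemma pw_initial (a b r : R) : 0 <= r < 3 / 2 -> a <= 1 -> b <= 1 / 2 ->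
  Rabs (pw a b 2 (r ^ 2)) <= 4.
Proof.
  intros Hr Ha Hb. rewrite Rabs_pos_eq by (left; apply pw_pos). unfold pw.
  assert (H1 : Rpower 2 a <= 2).
  { apply Rle_trans with (Rpower 2 1); [apply Rle_Rpower; lra | rewrite Rpower_1; lra]. }
  assert (H2 : Rpower (2 ^ 2 - r ^ 2) b <= 2).
  { apply Rle_trans with (Rpower (2 ^ 2 - r ^ 2) (/ 2)); [apply Rle_Rpower; nra |].
    apply Rle_trans with (Rpower (2 ^ 2) (/ 2)); [apply Rle_Rpower_l; nra |].
    rewrite Rpower_sqrt by lra. rewrite sqrt_pow2; lra. }
  replace 4 with (2 * 2) by ring.
  apply Rmult_le_compat; try assumption; left; apply Rpower_pos.
Qed.

Lemma pw_initial_C1 (a b r : R) :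
  0 <= r < 3 / 2 -> -2 <= a <= 0 -> -1 / 2 <= b <= 1 / 2 ->
  Rabs (pw a b 2 (r ^ 2)) <= 4 /\ Rabs (pw_t a b 2 (r ^ 2)) <= 12 /\
  Rabs (pw_m a b 2 (r ^ 2)) <= 2.
Proof.
  intros Hr Ha Hb.
  assert (prod : forall x y X Y, Rabs x <= X -> Rabs y <= Y -> Rabs (x * y) <= X * Y).
  { intros x y X Y Hx Hy. rewrite Rabs_mult. apply Rmult_le_compat; auto using Rabs_pos. }
  assert (h1 := pw_initial (a - 1) b r Hr ltac:(lra) ltac:(lra)).
  assert (h2 := pw_initial (a + 1) (b - 1) r Hr ltac:(lra) ltac:(lra)).
  assert (h3 := pw_initial a (b - 1) r Hr ltac:(lra) ltac:(lra)).
  split; [| split].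
  - apply pw_initial; lra.
  - unfold pw_t. eapply Rle_trans; [apply Rabs_triang |].
    assert (Rabs (a * pw (a - 1) b 2 (r ^ 2)) <= 2 * 4).
    { apply prod; [apply Rabs_le; lra | exact h1]. }
    assert (Rabs (2 * b * pw (a + 1) (b - 1) 2 (r ^ 2)) <= 1 * 4).
    { apply prod; [apply Rabs_le; lra | exact h2]. }
    lra.
  - unfold pw_m. assert (Rabs (- b * pw a (b - 1) 2 (r ^ 2)) <= 1 / 2 * 4).
    { apply prod; [apply Rabs_le; lra | exact h3]. }
    lra.
Qed.

(** The denominator factors along t - r and t + r, and (x - 2)^2 + 1 - x^2 / 5 = (2 x - 5)^2 / 5 is
    nonnegative; the two divisions by 5 give 25. In K one has t - r >= 1, so part of the decay in t
    - r can be given away to reach any exponent b >= -1. *)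
Lemma conf_upper (t r b : R) :
  2 <= t -> 0 <= r <= t - 1 -> -1 <= b ->
  conf t (r ^ 2) <= 25 * (Rpower t (-1) * Rpower (t - r) b).
Proof.
  intros Ht Hr Hb.
  assert (Hq : / (t - r) <= Rpower (t - r) b).
  { rewrite <- Rpower_m1 by lra. apply Rle_Rpower; lra. }
  rewrite Rpower_m1 by lra.
  apply Rle_trans with (25 * (/ t * / (t - r))).
  2:{ apply Rmult_le_compat_l; [lra |]. apply Rmult_le_compat_l; [| exact Hq].
      left. apply Rinv_0_lt_compat. lra. }
  unfold conf.
  assert (E : conf_den t (r ^ 2) = ((t - r - 2) ^ 2 + 1) * ((t + r - 2) ^ 2 + 1)).
  { unfold conf_den. ring. }
  assert (P1 : (t - r) ^ 2 / 5 <= (t - r - 2) ^ 2 + 1).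
  { generalize (pow2_ge_0 (2 * (t - r) - 5)). lra. }
  assert (P2 : (t + r) ^ 2 / 5 <= (t + r - 2) ^ 2 + 1).
  { generalize (pow2_ge_0 (2 * (t + r) - 5)). lra. }
  assert (Q1 : t - r <= (t - r) ^ 2) by nra.
  assert (Q2 : t ^ 2 <= (t + r) ^ 2) by nra.
  assert (Z : (t - r) / 5 * (t ^ 2 / 5) <= conf_den t (r ^ 2)).
  { rewrite E. apply Rmult_le_compat; nra. }
  assert (Hpos : 0 < (t - r) / 5 * (t ^ 2 / 5)) by (apply Rmult_lt_0_compat; nra).
  apply Rle_trans with (t * / ((t - r) / 5 * (t ^ 2 / 5))).
  - apply Rmult_le_compat; [lra | | lra |].
    + left. apply Rinv_0_lt_compat. lra.
    + apply Rinv_le_contravar; assumption.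
  - right. field. lra.
Qed.

(** After regrouping, all three terms are nonnegative; the middle one, -nu r / t, needs nu < 0. *)
Lemma outgoing_factor_pos (mu nu t r : R) :
  0 <= r < t -> 0 < mu -> -1 / 2 <= nu < 0 ->
  0 <= 1 + (-1 - nu - mu) * r / t + 2 * mu * r / (t + r).
Proof.
  intros Hr Hmu Hnu.
  replace (1 + (-1 - nu - mu) * r / t + 2 * mu * r / (t + r))
    with ((1 - r / t) + - nu * (r / t) + mu * (r * (t - r) / (t * (t + r)))) by (field; lra).
  assert (0 <= r / t) by (apply Rdiv_le_0_compat; lra).
  assert (r / t <= 1) by (apply Rle_div_l; lra).
  assert (0 <= r * (t - r) / (t * (t + r))) by (apply Rdiv_le_0_compat; nra).
  nra.
Qed.

(** For nu > 0 the second factor becomes negative near the light cone, but its power is subtracted,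
    so an upper bound is what matters. Both bounds are multiples of 1 - r / t, because r / (t + r)
    <= 1/2 and |mu - nu| <= 1/2 perturb it by at most a quarter. *)
Lemma outgoing_factor_dominates (mu nu t r : R) :
  0 <= r < t -> 0 < mu <= 1 / 2 -> 0 < nu <= 1 / 2 ->
  3 / 4 * (1 - r / t) <= 1 + (-1 - (mu - nu)) * r / t + 2 * (mu - nu) * r / (t + r) /\
  1 + (-1 - nu - mu) * r / t + 2 * mu * r / (t + r) <= 5 / 4 * (1 - r / t) /\ 0 <= 1 - r / t.
Proof.
  intros Hr Hmu Hnu.
  replace (1 + (-1 - (mu - nu)) * r / t + 2 * (mu - nu) * r / (t + r))
    with ((1 - r / t) + (1 - r / t) * ((mu - nu) * (r / (t + r)))) by (field; lra).
  replace (1 + (-1 - nu - mu) * r / t + 2 * mu * r / (t + r))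
    with ((1 - r / t) + (1 - r / t) * (mu * (r / (t + r))) - nu * (r / t)) by (field; lra).
  assert (0 <= r / t) by (apply Rdiv_le_0_compat; lra).
  assert (r / t <= 1) by (apply Rle_div_l; lra).
  assert (0 <= r / (t + r)) by (apply Rdiv_le_0_compat; lra).
  assert (r / (t + r) <= 1 / 2) by (apply Rle_div_l; lra).
  assert (0 <= 1 - r / t) by lra.
  assert (A1 : -1 / 4 <= (mu - nu) * (r / (t + r))) by nra.
  assert (A2 : mu * (r / (t + r)) <= 1 / 4) by nra.
  split; [| split]; nra.
Qed.

(** This fixes the exponents: s^(mu-1) supplies the power of t - r, and a = -1-nu-mu then makes the
    total power of t equal to -2-nu. *)
Lemma source_lower (mu nu t r : R) :
  0 <= r < t -> 0 < mu <= 1 / 2 ->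
  Rpower t (-2 - nu) * Rpower (t - r) (-1 + mu)
    <= 2 * pw (-1 - nu - mu) (mu - 1) t (r ^ 2).
Proof.
  intros Hr Hmu. assert (H := pw_lower (-1 - nu - mu) (mu - 1) t r Hr ltac:(lra)).
  replace (-1 - nu - mu + (mu - 1)) with (-2 - nu) in H by ring.
  replace (-1 + mu) with (mu - 1) by ring. lra.
Qed.

Lemma decay_neg (Cf mu nu : R) (u : R * R * R * R -> R) (p : R * R * R * R) :
  0 < Cf -> 0 < mu <= 1 / 2 -> -1 / 2 <= nu < 0 ->
  classical_regularity u ->
  (forall x1 x2 x3, u (2, x1, x2, x3) = 0) ->
  (forall x1 x2 x3, is_initial_dt u x1 x2 x3 0) ->
  (forall q, 2 < time q -> ~ K q -> Box u q = 0) ->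
  (forall q, 2 < time q -> K q -> Rabs (Box u q) <=
     Cf * Rpower (time q) (-2 - nu) * Rpower (time q - radius q) (-1 + mu)) ->
  2 < time p -> K p ->
  Rabs (u p) <= 100000 * (Cf / (- nu * mu) * Rpower (time p - radius p) mu
    * Rpower (time p) (-1 - nu)).
Proof.
  intros HCf Hmu Hnu Hu Hu0 Hdt HK Hf Hp HKp.
  (* Here 4 mu (a + mu + 1) = -4 nu mu, so c turns this coefficient into 2 Cf; the 2 makes up for
     the factor lost in [source_lower]. *)
  set (a := -1 - nu - mu). set (c := Cf / (2 * (- nu * mu))).
  assert (Hnm : 0 < - nu * mu) by nra.
  assert (Hc : 0 < c) by (apply Rdiv_lt_0_compat; lra).
  assert (Ha : -2 <= a <= 0) by (unfold a; lra).
  assert (Hwave : forall t r, 0 <= r < t ->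
     c * pw_tt a mu t (r ^ 2) - 4 * r ^ 2 * (c * pw_mm a mu t (r ^ 2))
     - 6 * (c * pw_m a mu t (r ^ 2))
     = c * (a * (a - 1)) * pw (a - 2) mu t (r ^ 2) + 2 * Cf * pw a (mu - 1) t (r ^ 2)).
  { intros t r Hr. assert (W := pw_wave a mu t (r ^ 2) ltac:(lra) ltac:(nra)).
    transitivity (c * (pw_tt a mu t (r ^ 2) - 4 * r ^ 2 * pw_mm a mu t (r ^ 2)
      - 6 * pw_m a mu t (r ^ 2))); [ring |].
    rewrite W. unfold c, a. field. lra. }
  assert (Haa : 0 <= c * (a * (a - 1))).
  { apply Rmult_le_pos; [lra |]. nra. }
  assert (B := barrier (fun t m => c * pw a mu t m) (fun t m => c * pw_t a mu t m)
    (fun t m => c * pw_m a mu t m) (fun t m => c * pw_tt a mu t m)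
    (fun t m => c * pw_tm a mu t m) (fun t m => c * pw_mm a mu t m) c u p).
  cbv beta in B.
  eapply Rle_trans; [apply B; try assumption |].
  - intros t m Ht Hm Hmt. apply C2_at_scal, pw_C2; lra.
  - intros t r _ _. apply Rmult_le_pos; [lra | left; apply pw_pos].
  - intros t r _ Hr.
    replace (c * pw a mu t (r ^ 2) + r * (c * pw_t a mu t (r ^ 2))
      + 2 * r ^ 2 * (c * pw_m a mu t (r ^ 2)))
      with (c * (pw a mu t (r ^ 2) + r * pw_t a mu t (r ^ 2) + 2 * r ^ 2 * pw_m a mu t (r ^ 2)))
      by ring.
    rewrite pw_outgoing by exact Hr.
    apply Rmult_le_pos; [lra |]. apply Rmult_le_pos; [left; apply pw_pos |].
    apply outgoing_factor_pos; [exact Hr | lra | exact Hnu].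
  - intros t r _ Hr. rewrite Hwave by exact Hr.
    apply Rplus_le_le_0_compat; apply Rmult_le_pos; try lra; left; apply pw_pos.
  - lra.
  - intros r Hr. destruct (pw_initial_C1 a mu r Hr Ha ltac:(lra)) as (h1 & h2 & h3).
    rewrite !Rabs_mult, (Rabs_pos_eq c) by lra. repeat split; nra.
  - intros q Hq HKq. eapply Rle_trans; [apply (Hf q Hq HKq) |].
    assert (Hr : 0 <= radius q < time q).
    { split; [apply radius_nonneg | unfold K in HKq; lra]. }
    rewrite Hwave by exact Hr.
    assert (S := source_lower mu nu (time q) (radius q) Hr Hmu). fold a in S.
    assert (P := pw_pos (a - 2) mu (time q) (radius q ^ 2)).
    assert (0 <= c * (a * (a - 1)) * pw (a - 2) mu (time q) (radius q ^ 2))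
      by (apply Rmult_le_pos; lra).
    rewrite Rmult_assoc.
    apply Rle_trans with (Cf * (2 * pw a (mu - 1) (time q) (radius q ^ 2))); [| lra].
    apply Rmult_le_compat_l; lra.
  - assert (Hr : 0 <= radius p <= time p - 1).
    { split; [apply radius_nonneg | unfold K in HKp; lra]. }
    set (t := time p) in *. set (r := radius p) in *.
    assert (U := pw_upper a mu t r ltac:(lra) ltac:(lra)).
    replace (a + mu) with (-1 - nu) in U by (unfold a; ring).
    assert (Z := conf_upper t r mu ltac:(lra) Hr ltac:(lra)).
    (* The compensator only needs the decay t^(-1), which is below the target since nu < 0. *)
    assert (T : Rpower t (-1) <= Rpower t (-1 - nu)) by (apply Rle_Rpower; lra).
    assert (Q := Rpower_pos (t - r) mu).
    assert (T' : Rpower t (-1) * Rpower (t - r) mu <= Rpower t (-1 - nu) * Rpower (t - r) mu)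
      by (apply Rmult_le_compat_r; lra).
    set (Y := Rpower t (-1 - nu) * Rpower (t - r) mu) in *.
    assert (HY : 0 < Y) by (apply Rmult_lt_0_compat; apply Rpower_pos).
    replace (Cf / (- nu * mu) * Rpower (t - r) mu * Rpower t (-1 - nu)) with (2 * c * Y)
      by (unfold c, Y; field; lra).
    apply Rle_trans with (c * (2 * Y) + 600 * c * (25 * Y)).
    + apply Rplus_le_compat; apply Rmult_le_compat_l; lra.
    + assert (0 < c * Y) by (apply Rmult_lt_0_compat; assumption). lra.
Qed.

Lemma decay_pos (Cf mu nu : R) (u : R * R * R * R -> R) (p : R * R * R * R) :
  0 < Cf -> 0 < mu <= 1 / 2 -> 0 < nu <= 1 / 2 ->
  classical_regularity u ->
  (forall x1 x2 x3, u (2, x1, x2, x3) = 0) ->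
  (forall x1 x2 x3, is_initial_dt u x1 x2 x3 0) ->
  (forall q, 2 < time q -> ~ K q -> Box u q = 0) ->
  (forall q, 2 < time q -> K q -> Rabs (Box u q) <=
     Cf * Rpower (time q) (-2 - nu) * Rpower (time q - radius q) (-1 + mu)) ->
  2 < time p -> K p ->
  Rabs (u p) <= 100000 * (Cf / (nu * mu) * Rpower (time p - radius p) (mu - nu) * / time p).
Proof.
  intros HCf Hmu Hnu Hu Hu0 Hdt HK Hf Hp HKp.
  (* The power with (a1, b) has the decay of the claim, and a1 + b + 1 = 0 removes the s^(b-1) term
     of its wave operator. *)
  set (b := mu - nu). set (a1 := -1 - b). set (a2 := -1 - nu - mu).
  set (c := Cf / (2 * (nu * mu))).
  assert (Hnm : 0 < nu * mu) by nra.
  assert (Hc : 0 < c) by (apply Rdiv_lt_0_compat; lra).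
  assert (Ha1 : -2 <= a1 <= 0) by (unfold a1, b; lra).
  assert (Ha2 : -2 <= a2 <= 0) by (unfold a2; lra).
  assert (Hb : -1 / 2 <= b <= 1 / 2) by (unfold b; lra).
  assert (cmp : forall k t r, 0 <= r < t ->
     pw (a2 - k) mu t (r ^ 2) <= pw (a1 - k) b t (r ^ 2)).
  { intros k t r Hr. assert (H := pw_compare (a1 - k) b nu t r Hr ltac:(lra)).
    replace (a1 - k - 2 * nu) with (a2 - k) in H by (unfold a1, a2, b; ring).
    replace (b + nu) with mu in H by (unfold b; ring). exact H. }
  assert (cmp0 : forall t r, 0 <= r < t -> pw a2 mu t (r ^ 2) <= pw a1 b t (r ^ 2)).
  { intros t r Hr. generalize (cmp 0 t r Hr). rewrite !Rminus_0_r. auto. }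
  assert (Hwave : forall t r, 0 <= r < t ->
     2 * Cf * pw a2 (mu - 1) t (r ^ 2) <=
     (8 * c * pw_tt a1 b t (r ^ 2) + - c * pw_tt a2 mu t (r ^ 2))
     - 4 * r ^ 2 * (8 * c * pw_mm a1 b t (r ^ 2) + - c * pw_mm a2 mu t (r ^ 2))
     - 6 * (8 * c * pw_m a1 b t (r ^ 2) + - c * pw_m a2 mu t (r ^ 2))).
  { intros t r Hr.
    assert (W1 := pw_wave a1 b t (r ^ 2) ltac:(lra) ltac:(nra)).
    assert (W2 := pw_wave a2 mu t (r ^ 2) ltac:(lra) ltac:(nra)).
    replace (a1 + b + 1) with 0 in W1 by (unfold a1; ring).
    replace (a2 + mu + 1) with (- nu) in W2 by (unfold a2; ring).
    set (Y1 := pw (a1 - 2) b t (r ^ 2)) in *. set (Y2 := pw (a2 - 2) mu t (r ^ 2)) in *.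
    assert (HY1 : 0 < Y1) by apply pw_pos. assert (HY2 : 0 < Y2) by apply pw_pos.
    assert (HY : Y2 <= Y1) by apply (cmp 2 t r Hr).
    (* Origin of the 8: a1 <= -1/2 gives 3/4 here, a2 >= -2 gives 6 in the next line, and 8 * 3/4 =
       6. *)
    assert (k1 : 3 / 4 <= a1 * (a1 - 1)) by (unfold a1; nra).
    assert (k2 : a2 * (a2 - 1) <= 6) by nra.
    assert (E : 2 * Cf * pw a2 (mu - 1) t (r ^ 2) = c * (4 * mu * nu * pw a2 (mu - 1) t (r ^ 2)))
      by (unfold c; field; lra).
    rewrite E.
    apply Rle_trans with (8 * c * (pw_tt a1 b t (r ^ 2) - 4 * r ^ 2 * pw_mm a1 b t (r ^ 2)
      - 6 * pw_m a1 b t (r ^ 2)) + - c * (pw_tt a2 mu t (r ^ 2)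
      - 4 * r ^ 2 * pw_mm a2 mu t (r ^ 2) - 6 * pw_m a2 mu t (r ^ 2))); [| right; ring].
    rewrite W1, W2.
    assert (L1 : 3 / 4 * Y1 <= a1 * (a1 - 1) * Y1) by (apply Rmult_le_compat_r; lra).
    assert (L2 : a2 * (a2 - 1) * Y2 <= 6 * Y2) by (apply Rmult_le_compat_r; lra).
    assert (L3 : 0 <= c * (8 * (a1 * (a1 - 1) * Y1) - a2 * (a2 - 1) * Y2))
      by (apply Rmult_le_pos; lra).
    lra. }
  assert (B := barrier (fun t m => 8 * c * pw a1 b t m + - c * pw a2 mu t m)
    (fun t m => 8 * c * pw_t a1 b t m + - c * pw_t a2 mu t m)
    (fun t m => 8 * c * pw_m a1 b t m + - c * pw_m a2 mu t m)
    (fun t m => 8 * c * pw_tt a1 b t m + - c * pw_tt a2 mu t m)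
    (fun t m => 8 * c * pw_tm a1 b t m + - c * pw_tm a2 mu t m)
    (fun t m => 8 * c * pw_mm a1 b t m + - c * pw_mm a2 mu t m) (9 * c) u p).
  cbv beta in B.
  eapply Rle_trans; [apply B; try assumption |].
  - intros t m Ht Hm Hmt. apply C2_at_plus; apply C2_at_scal, pw_C2; lra.
  - intros t r _ Hr. assert (P := pw_pos a1 b t (r ^ 2)). assert (H := cmp0 t r Hr).
    assert (0 <= c * (8 * pw a1 b t (r ^ 2) - pw a2 mu t (r ^ 2)))
      by (apply Rmult_le_pos; lra). lra.
  - intros t r _ Hr.
    assert (O1 := pw_outgoing a1 b t r Hr). assert (O2 := pw_outgoing a2 mu t r Hr).
    apply Rle_trans with (8 * c * (pw a1 b t (r ^ 2) + r * pw_t a1 b t (r ^ 2)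
      + 2 * r ^ 2 * pw_m a1 b t (r ^ 2)) + - c * (pw a2 mu t (r ^ 2) + r * pw_t a2 mu t (r ^ 2)
      + 2 * r ^ 2 * pw_m a2 mu t (r ^ 2))); [| right; ring].
    rewrite O1, O2.
    destruct (outgoing_factor_dominates mu nu t r Hr Hmu Hnu) as (d1 & d2 & d3).
    fold b in d1. fold a1 in d1. fold a2 in d2.
    assert (P := pw_pos a1 b t (r ^ 2)). assert (P2 := pw_pos a2 mu t (r ^ 2)).
    assert (H := cmp0 t r Hr).
    set (Y1 := pw a1 b t (r ^ 2)) in *. set (Y2 := pw a2 mu t (r ^ 2)) in *.
    set (F1 := 1 + a1 * r / t + 2 * b * r / (t + r)) in *.
    set (F2 := 1 + a2 * r / t + 2 * mu * r / (t + r)) in *.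
    set (y := 1 - r / t) in *.
    assert (L1 : Y1 * (3 / 4 * y) <= Y1 * F1) by (apply Rmult_le_compat_l; lra).
    assert (L2 : Y2 * F2 <= Y2 * (5 / 4 * y)) by (apply Rmult_le_compat_l; lra).
    assert (L3 : Y2 * y <= Y1 * y) by (apply Rmult_le_compat_r; lra).
    assert (L4 : 0 <= Y1 * y) by (apply Rmult_le_pos; lra).
    (* Here the weight 8 leaves ample room: 8 * 3/4 against 5/4. *)
    assert (L5 : 0 <= c * (8 * (Y1 * F1) - Y2 * F2)) by (apply Rmult_le_pos; lra).
    lra.
  - intros t r _ Hr. eapply Rle_trans; [| apply (Hwave t r Hr)].
    apply Rmult_le_pos; [lra | left; apply pw_pos].
  - lra.
  - intros r Hr. destruct (pw_initial_C1 a1 b r Hr Ha1 Hb) as (h1 & h2 & h3).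
    destruct (pw_initial_C1 a2 mu r Hr Ha2 ltac:(lra)) as (k1 & k2 & k3).
    (* The initial data have size 9 c, namely 8 c + c from the two powers. *)
    assert (S : forall x y k, Rabs x <= k -> Rabs y <= k ->
       Rabs (8 * c * x + - c * y) <= k * (9 * c)).
    { intros x y k Hx Hy. eapply Rle_trans; [apply Rabs_triang |].
      rewrite !Rabs_mult, Rabs_Ropp, (Rabs_pos_eq 8), (Rabs_pos_eq c) by lra.
      assert (c * Rabs x <= c * k) by (apply Rmult_le_compat_l; lra).
      assert (c * Rabs y <= c * k) by (apply Rmult_le_compat_l; lra). lra. }
    repeat split; apply S; assumption.
  - intros q Hq HKq. eapply Rle_trans; [apply (Hf q Hq HKq) |].
    assert (Hr : 0 <= radius q < time q).
    { split; [apply radius_nonneg | unfold K in HKq; lra]. }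
    eapply Rle_trans; [| apply (Hwave _ _ Hr)].
    assert (S := source_lower mu nu (time q) (radius q) Hr Hmu). fold a2 in S.
    rewrite Rmult_assoc.
    apply Rle_trans with (Cf * (2 * pw a2 (mu - 1) (time q) (radius q ^ 2))); [| lra].
    apply Rmult_le_compat_l; lra.
  - assert (Hr : 0 <= radius p <= time p - 1).
    { split; [apply radius_nonneg | unfold K in HKp; lra]. }
    set (t := time p) in *. set (r := radius p) in *.
    assert (U := pw_upper a1 b t r ltac:(lra) ltac:(lra)).
    replace (a1 + b) with (-1) in U by (unfold a1; ring).
    assert (Z := conf_upper t r b ltac:(lra) Hr ltac:(lra)).
    assert (P2 := pw_pos a2 mu t (r ^ 2)).
    set (Y := Rpower t (-1) * Rpower (t - r) b) in *.
    assert (HY : 0 < Y) by (apply Rmult_lt_0_compat; apply Rpower_pos).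
    replace (Cf / (nu * mu) * Rpower (t - r) b * / t) with (2 * c * Y)
      by (unfold c, Y; rewrite Rpower_m1 by lra; field; lra).
    assert (0 < c * pw a2 mu t (r ^ 2)) by (apply Rmult_lt_0_compat; assumption).
    apply Rle_trans with (8 * c * (2 * Y) + 600 * (9 * c) * (25 * Y)).
    + apply Rplus_le_compat.
      * assert (8 * c * pw a1 b t (r ^ 2) <= 8 * c * (2 * Y))
          by (apply Rmult_le_compat_l; lra). lra.
      * apply Rmult_le_compat_l; lra.
    + assert (0 < c * Y) by (apply Rmult_lt_0_compat; assumption). lra.
Qed.

Theorem proposition3p1 :
  exists C : R, 0 < C /\
  forall (Cf mu nu : R) (u f : R * R * R * R -> R),
    0 < Cf ->
    0 < mu <= 1 / 2 ->
    0 < Rabs nu <= 1 / 2 ->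
    classical_regularity u ->
    spatially_compactly_supported_in_K u ->
    spatially_compactly_supported_in_K f ->
    (forall p, 2 < time p -> - Box u p = f p) ->
    (forall x1 x2 x3, u (2, x1, x2, x3) = 0) ->
    (forall x1 x2 x3, is_initial_dt u x1 x2 x3 0) ->
    (forall p, K p -> 2 <= time p ->
       Rabs (f p) <=
         Cf * Rpower (time p) (- 2 - nu)
            * Rpower (time p - radius p) (- 1 + mu)) ->
    forall p, K p -> 2 <= time p ->
      (0 < nu ->
         Rabs (u p) <=
           C * (Cf / (nu * mu) * Rpower (time p - radius p) (mu - nu)
                * / time p)) /\
      (nu < 0 ->
         Rabs (u p) <=
           C * (Cf / (Rabs nu * mu) * Rpower (time p - radius p) mu
                * Rpower (time p) (- 1 - nu))).
Proof.
  (* With 2 c Y the right-hand side without its constant, the two cases produce 15002 c Y and 135016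
     c Y, both below 200000 c Y. *)
  exists 100000. split; [lra |].
  intros Cf mu nu u f HCf Hmu Hnu Hu _ [Hf0 _] Heq Hu0 Hdt Hf p HKp Hp.
  assert (HK : forall q, 2 < time q -> ~ K q -> Box u q = 0).
  { intros q Hq HKq. generalize (Heq q Hq), (Hf0 q (Rlt_le _ _ Hq) HKq). lra. }
  assert (HB : forall q, 2 < time q -> K q -> Rabs (Box u q) <=
     Cf * Rpower (time q) (-2 - nu) * Rpower (time q - radius q) (-1 + mu)).
  { intros q Hq HKq. rewrite <- Rabs_Ropp, (Heq q Hq). apply Hf; [exact HKq | lra]. }
  destruct (Rle_lt_or_eq_dec 2 (time p) Hp) as [Hlt | E].
  - split; intros Hs.
    + rewrite Rabs_pos_eq in Hnu by lra. apply decay_pos; assumption.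
    + rewrite (Rabs_left nu Hs) in *. apply decay_neg; try assumption. lra.
  - assert (Eu : u p = 0).
    { destruct p as [[[t x1] x2] x3]. simpl in E. subst t. apply Hu0. }
    rewrite Eu, Rabs_R0.
    split; intros Hs; apply Rmult_le_pos; try lra; repeat apply Rmult_le_pos;
      try lra; try (left; apply Rpower_pos); left; apply Rinv_0_lt_compat.
    + nra.
    + lra.
    + apply Rmult_lt_0_compat; lra.
Qed.
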